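(* The extended binary search tree $\overline{\mathcal B}_n$ has a limiting random fringe tree $\overline{\mathcal B}^*_\infty$ with distribution given by, for every full binary tree $t$ with $|t|_{\mathsf i}=k>0$ internal nodes, $$\mathbb{P}(\overline{\mathcal B}^*_\infty=t)=\tfrac12\mathbb{P}(\mathcal B^*_\infty=t^\circ)=\frac{1}{(k+1)(k+2)}\mathbb{P}(\mathcal B_k=t^\circ),$$ and (for the trivial case $|t|_{\mathsf i}=0$) $\mathbb{P}(\overline{\mathcal B}^*_\infty=\bullet)=\tfrac12$. Moreover, for $t=\bullet$ we have $N_\bullet(\overline{\mathcal B}_n)=n+1$, and for any full binary tree $t$ with $|t|_{\mathsf e}>1$, $N_t(\overline{\mathcal B}_n)$ is asymptotically normal: there exist constants $\bar\beta_t>0$ and $\bar\gamma_t>0$ such that, as $n\to\infty$, $$\frac{N_t(\overline{\mathcal B}_n)-n\bar\beta_t}{\sqrt n}\overset{\mathrm d}{\longrightarrow}N(0,\bar\gamma_t^2),$$ with convergence of mean and variance, where, with $k=|t|_{\mathsf i}$, $$\bar\beta_t=2\mathbb{P}(\overline{\mathcal B}^*_\infty=t)=\mathbb{P}(\mathcal B^*_\infty=t^\circ)=\frac{2}{(k+1)(k+2)}\mathbb{P}(\mathcal B_k=t^\circ).$$ In particular, for every full binary tree $t$ (with $\bar\beta_\bullet:=1$), $N_t(\overline{\mathcal B}_n)/n\overset{\mathrm p}{\longrightarrow}\bar\beta_t$. Consequently, the fringe tree distribution converges to the limit $\overline{\mathcal B}^*_\infty$ both in the quenched and the annealed sense: for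 every full binary tree $t$, $$\mathbb{P}(\overline{\mathcal B}^*_n=t\mid\overline{\mathcal B}_n)=\frac{N_t(\overline{\mathcal B}_n)}{|\overline{\mathcal B}_n|}\overset{\mathrm p}{\longrightarrow}\mathbb{P}(\overline{\mathcal B}^*_\infty=t),\qquad \mathbb{P}(\overline{\mathcal B}^*_n=t)=\mathbb{E}\frac{N_t(\overline{\mathcal B}_n)}{|\overline{\mathcal B}_n|}\to\mathbb{P}(\overline{\mathcal B}^*_\infty=t).$$
   Context: Trees. A binary tree is a (finite, non-empty) rooted tree in which each child is labelled left or right and each node has at most one left and at most one right child. It is full if each node has outdegree 0 or 2. A leaf (external node) is a node of outdegree 0; other nodes are internal. $|T|$, $|T|_{\mathsf e}$, $|T|_{\mathsf i}$ are the numbers of nodes, leaves and internal nodes of $T$. $\bullet$ is the tree with one node. For $v\in T$, the fringe tree $T^v$ consists of $v$ and all its descendants, and $N_t(T):=|\{v\in T:T^v=t\}|$ (equality as binary trees). The random fringe tree $T^*$ of a tree $T$ is $T^v$ for a uniformly random node $v$ of $T$ (if $T$ is random, first condition on $T$). The extension $\overline T$ of a binary tree $T$ is the full binary tree obtained by adding new leaves at all possible places (one to each node of outdegree 1, two to each node of outdegree 0). For a full binary tree $t$ with $|t|_{\mathsf e}>1$, $t^\circ$ is the binary tree formed by its internal nodes, so $t=\overline{t^\circ}$. Binary search tree. The random binary search tree $\mathcal B_n$ is defined recursively from $n$ distinct real numbers: $\mathcal B_0$ is empty, $\mathcal B_1=\bullet$, and for $n\ge2$ a uniformly random one of the numbers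 (the pivot) is chosen at the root, and the left and right subtrees of the root are constructed recursively, independently, from the set of numbers smaller, respectively larger, than the pivot. So $|\mathcal B_n|=n$. $\overline{\mathcal B}_n$ is the extension of $\mathcal B_n$ (it has $n$ internal nodes and $n+1$ leaves), and $\overline{\mathcal B}^*_n$ its random fringe tree. $\mathcal B^*_\infty$ is the random binary tree with distribution $\mathbb{P}(\mathcal B^*_\infty\in\mathfrak S)=\sum_{k=1}^\infty\frac{2}{(k+1)(k+2)}\mathbb{P}(\mathcal B_k\in\mathfrak S)$ for every set $\mathfrak S$ of binary trees. ''Convergence of mean and variance'' means that the mean and variance of the left-hand side converge to those of the limit. *)

(* Defs.v *)
(* MathComp-Analysis. *)
From HB Require Import structures.
From mathcomp Require Import all_boot all_order all_algebra.
From mathcomp Require Import all_classical all_reals all_analysis.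
Set Implicit Arguments.
Unset Strict Implicit.
Unset Printing Implicit Defensive.
Import Order.TTheory GRing.Theory Num.Theory.
Import numFieldNormedType.Exports.
Local Open Scope classical_set_scope.
Local Open Scope ring_scope.

(* A possibly empty binary tree; [Node l r] is a root with left and right
   subtrees [l] and [r], a missing child being an [EmptyTree] subtree. The binary
   trees in the sense of the literature are the values other than [EmptyTree]. *)
Inductive btree : Type := EmptyTree | Node of btree & btree.

Fixpoint btree_encode (t : btree) : GenTree.tree unit :=
  match t with
  | EmptyTree => GenTree.Leaf tt
  | Node l r => GenTree.Node 0 [:: btree_encode l; btree_encode r]
  end.

Fixpoint btree_decode (g : GenTree.tree unit) : btree :=
  match g with
  | GenTree.Node _ [:: l; r] => Node (btree_decode l) (btree_decode r)
  | _ => EmptyTree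
  end.

Lemma btree_encodeK : cancel btree_encode btree_decode.
Proof. by elim=> //= l -> r ->. Qed.

HB.instance Definition _ := Countable.copy btree (can_type btree_encodeK).
HB.instance Definition _ := isPointed.Build btree EmptyTree.
HB.instance Definition _ := @isMeasurable.Build default_measure_display
  btree discrete_measurable discrete_measurable0
  discrete_measurableC discrete_measurableU.

(* The one-node tree. *)
Definition bullet : btree := Node EmptyTree EmptyTree.

(* A node is identified with its path from the root; [false] stands for left
   and [true] for right. *)
Fixpoint nodes (T : btree) : seq (seq bool) :=
  match T with
  | EmptyTree => [::]
  | Node l r =>
      [::] :: [seq false :: v | v <- nodes l] ++ [seq true :: v | v <- nodes r]
  end.

(* The fringe tree T^v. *)
Fixpoint fringe (T : btree) (v : seq bool) : btree :=
  match T, v with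
  | Node l r, b :: v' => fringe (if b then r else l) v'
  | _, _ => T
  end.

Definition outdeg (T : btree) (v : seq bool) : nat :=
  match fringe T v with
  | EmptyTree => 0
  | Node l r => (l != EmptyTree) + (r != EmptyTree)
  end.

Definition nb_nodes (T : btree) : nat := size (nodes T).

Definition nb_leaves (T : btree) : nat :=
  count (fun v => outdeg T v == 0)%N (nodes T).

Definition nb_internal (T : btree) : nat :=
  count (fun v => outdeg T v != 0)%N (nodes T).

Definition full (T : btree) : bool :=
  (T != EmptyTree) && all (fun v => outdeg T v \in [:: 0; 2]%N) (nodes T).

(* N_t(T) *)
Definition nb_fringe (t T : btree) : nat :=
  count (fun v => fringe T v == t) (nodes T).

(* The extension of T: every missing child becomes a leaf. For the empty tree
   this yields the one-node tree, with 0 internal nodes and 1 leaf. *)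
Fixpoint extension (T : btree) : btree :=
  match T with
  | EmptyTree => bullet
  | Node l r => Node (extension l) (extension r)
  end.

(* The subtree formed by the internal nodes (empty for the one-node tree). *)
Fixpoint internal (T : btree) : btree :=
  match T with
  | EmptyTree => EmptyTree
  | Node EmptyTree EmptyTree => EmptyTree
  | Node l r => Node (internal l) (internal r)
  end.

(* The probability that the fringe tree of T at a uniformly random node lies in
   the set A. *)
Definition fringe_prob (R : realType) (T : btree) (A : set btree) : R :=
  (count (fun v => `[< A (fringe T v) >]) (nodes T))%:R / (nb_nodes T)%:R.

(* The same probability for a random tree X w, where w has law P: condition on
   the tree, then average. *)
Definition random_fringe_prob d (W : measurableType d) (R : realType)
    (P : probability W R) (X : W -> btree) (A : set btree) : \bar R :=
  'E_P[fun w => fringe_prob R (X w) A].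

(* Probability that the random binary search tree built from the keys s is t.
   The tree is EmptyTree iff there are no keys; otherwise the pivot x is uniform in
   s, and given x the two subtrees are independent binary search trees built
   from the smaller and from the larger keys. *)
Fixpoint bst_pmf (R : realType) (s : seq R) (t : btree) : R :=
  match t with
  | EmptyTree => (s == [::])%:R
  | Node l r =>
      (size s)%:R^-1 * \sum_(x <- s)
        bst_pmf [seq y <- s | y < x] l * bst_pmf [seq y <- s | x < y] r
  end.

Definition bst_prob (R : realType) (s : seq R) : set btree -> \bar R :=
  fun A => \esum_(t in A) (bst_pmf s t)%:E.

Section bst_pmf_theory.
Context {R : realType}.
Implicit Types s : seq R.

Lemma bst_pmf_ge0 s t : 0 <= bst_pmf s t.
Proof.
elim: t s => [|l IHl r IHr] s /=; first exact: ler0n.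
rewrite mulr_ge0 ?invr_ge0 ?ler0n// sumr_ge0// => x _.
by rewrite mulr_ge0.
Qed.

Fixpoint trees (h : nat) : seq btree :=
  if h is h'.+1 then
    EmptyTree :: [seq Node l r | l <- trees h', r <- trees h']
  else [:: EmptyTree].

Lemma trees_uniq h : uniq (trees h).
Proof.
elim: h => //= h IH; apply/andP; split.
  by apply/negP => /allpairsP[[l r]] [].
by apply: allpairs_uniq => // -[a b] [c e] _ _ [-> ->].
Qed.

Lemma size_filter_lt s (x : R) (a : pred R) :
  x \in s -> ~~ a x -> (size [seq y <- s | a y] < size s)%N.
Proof.
move=> xs ax; rewrite size_filter -(count_predC a s) -[ltnLHS]addn0 ltn_add2l.
by rewrite -has_count; apply/hasP; exists x.
Qed.

Lemma bst_pmf_trees h s t : (size s <= h)%N -> t \notin trees h ->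
  bst_pmf s t = 0.
Proof.
elim: t h s => [|l IHl r IHr] [|h] s //=.
- by rewrite leqn0 size_eq0 => /eqP-> _; rewrite big_nil mulr0.
- move=> sh; rewrite inE /= => lr; rewrite big_seq big1 ?mulr0// => x xs.
  have [ll|] := boolP (l \in trees h); last first.
    move=> nl; rewrite (IHl h) ?mul0r// -ltnS (leq_trans _ sh)//.
    by apply: (size_filter_lt xs); rewrite ltxx.
  have [rr|nr] := boolP (r \in trees h); last first.
    rewrite (IHr h) ?mulr0// -ltnS (leq_trans _ sh)//.
    by apply: (size_filter_lt xs); rewrite ltxx.
  by case/negP: lr; apply/allpairsP; exists (l, r).
Qed.

Lemma bst_pmf_sum h s : (size s <= h)%N -> \sum_(t <- trees h) bst_pmf s t = 1.
Proof.
elim: h s => [|h IH] s.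
  by rewrite leqn0 size_eq0 => /eqP-> /=; rewrite big_seq1.
move=> sh; rewrite /= big_cons big_allpairs_dep /=.
have [->|s0] := eqVneq s [::].
  rewrite /= big1 ?addr0// => l _; rewrite big1// => r _.
  by rewrite big_nil mulr0.
rewrite add0r.
under eq_bigr do rewrite -mulr_sumr exchange_big /=.
rewrite -mulr_sumr exchange_big /= big_seq.
rewrite (eq_bigr (fun=> 1)) => [|x xs]; last first.
  under eq_bigr do rewrite -mulr_sumr.
  rewrite -mulr_suml !IH ?mulr1// -ltnS (leq_trans _ sh)//;
    by apply: (size_filter_lt xs); rewrite ltxx.
rewrite -big_seq big_const_seq count_predT iter_addr_0 mulVf//.
by rewrite pnatr_eq0 size_eq0.
Qed.

End bst_pmf_theory.

Section bst_probability.
Context {R : realType} (s : seq R).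
Local Open Scope ereal_scope.
Local Notation bst := (bst_prob s).

Let bst0 : bst set0 = 0.
Proof. by rewrite /bst_prob esum_set0. Qed.

Let bst_ge0 A : 0 <= bst A.
Proof. by apply: esum_ge0 => t _; rewrite lee_fin bst_pmf_ge0. Qed.

Let bst_sigma_additive : semi_sigma_additive bst.
Proof.
move=> F mF tF mUF; rewrite /bst_prob; apply: cvg_toP.
  apply: ereal_nondecreasing_is_cvgn => a b ab.
  apply: lee_sum_nneg_natr => // k _ _.
  by apply: esum_ge0 => ? _; rewrite lee_fin bst_pmf_ge0.
by rewrite nneseries_sum_bigcup// => i; rewrite lee_fin bst_pmf_ge0.
Qed.

HB.instance Definition _ := isMeasure.Build _ _ _ bst
  bst0 bst_ge0 bst_sigma_additive.

Let bst_setT : bst [set: _] = 1.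
Proof.
rewrite /bst_prob (esumID [set` trees (size s)])//; last first.
  by move=> t _; rewrite lee_fin bst_pmf_ge0.
rewrite [X in _ + X]esum1 ?adde0; last first.
  by move=> t [_ /= /negP ts]; rewrite (@bst_pmf_trees _ (size s)).
have ts : finite_set [set` trees (size s)] by exact: finite_seq.
rewrite setTI esum_fset//; last by move=> t _; rewrite lee_fin bst_pmf_ge0.
by rewrite -fsbig_seq ?trees_uniq// sumEFin bst_pmf_sum.
Qed.

HB.instance Definition _ :=
  @Measure_isProbability.Build _ _ R bst bst_setT.

End bst_probability.

(* The limiting random fringe tree B*_oo of the binary search trees B_k, where
   B_k is built from keys k. *)
Definition bst_fringe_limit (R : realType) (keys : nat -> seq R)
    (A : set btree) : \bar R :=
  (\sum_(1 <= k <oo)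
     (2 / ((k%:R + 1) * (k%:R + 2)))%:E * bst_prob (keys k) A)%E.

Section btree_rv.
Context {R : realType}.

(* Every function on trees is measurable. *)
Definition btree_rv (f : btree -> R) : btree -> R := f.

Let measurable_btree_rv f : measurable_fun setT (btree_rv f).
Proof. by []. Qed.

HB.instance Definition _ f :=
  isMeasurableFun.Build _ _ _ _ (btree_rv f) (measurable_btree_rv f).

End btree_rv.

Definition cvg_in_distribution (R : realType) d (W : measurableType d)
    (P : nat -> probability W R) (X : forall n, {RV (P n) >-> R})
    (mu : probability (measurableTypeR R) R) : Prop :=
  forall x : R, {for x, continuous (fun y : R => fine (mu `]-oo, y]%classic))} ->
    (fun n => cdf (X n) x) @ \oo --> mu `]-oo, x]%classic.

Definition cvg_in_probability (R : realType) d (W : measurableType d)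
    (P : nat -> probability W R) (X : forall n, {RV (P n) >-> R})
    (c : R) : Prop :=
  forall e : R, 0 < e ->
    (fun n => P n [set w | e <= `|X n w - c|]) @ \oo --> 0%E.

(* Main.v *)
(* Let X be the number of fringe copies of t in the extension of B_n, centered
   by beta (n + 1). The recursive construction of B_n makes the centered law an
   equal mixture over j < n of convolutions of the laws at j and n - 1 - j, for
   all large n, and the same is true of the Gaussian of variance v (n + 1).
   Hence means and variances are exactly linear in n + 1, and v > 0 because the
   centered law at n = 0 is the constant - beta. Write e_n for the distance
   between both laws tested against functions with third derivative at most 1.
   Replacing one summand at a time gives e_n <= (2 / n) sum_(j < n) e_j + C,
   the finitely many j whose first two moments do not match those of the
   Gaussian costing only O(1), as their mismatches sum to 0. So e_n = O(n), while rescaling by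
   n^(-1/2) multiplies it by n^(-3/2), which gives the central limit theorem. *)
Require Import Defs.
From HB Require Import structures.
From mathcomp Require Import all_boot all_order all_algebra.
From mathcomp Require Import all_classical all_reals all_analysis.
From mathcomp Require Import measurable_realfun zify ring lra.
Set Implicit Arguments.
Unset Strict Implicit.
Unset Printing Implicit Defensive.
Import Order.TTheory GRing.Theory Num.Theory.
Import numFieldNormedType.Exports.
Local Open Scope classical_set_scope.
Local Open Scope ring_scope.

(** The centering uses a multiple of [n + 1], the number of leaves of the extension, because this
    number adds up exactly over the two subtrees; centering by [n * beta] would leave a drift in
    every step of the recursion. The obstacle lies at small indices, where the centered law has
    neither mean 0 nor variance [v * (j + 1)], so its distance to the Gaussian is not of third
    order. The error is therefore measured after subtracting the mismatches times the first and
    second derivatives of the test function at 0. In a convolution these derivatives appear averaged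
    over the other summand. Moving them back to 0 costs O(n) for each of finitely many [j], hence
    O(1) after division by [n]. Where the other summand has not yet been replaced by a Gaussian,
    this needs its exact moments, which is why the recursion is used only from [2 * N] on: then one
    of [j] and [n - 1 - j] is at least [N]. The law of B_n depends on the keys only through their
    number, so the whole recursion is carried out on finite sums over trees, and measures enter only
    at the end. *)

(** * Gaussian means *)

Section gaussian_mean.
Context {R : realType}.
Implicit Types (s u x y : R) (f g : R -> R).
Local Notation mu := (@lebesgue_measure R).

Definition gauss_integrable s f :=
  mu.-integrable setT (EFin \o (fun y => f y * normal_pdf 0 s y)).

Definition gauss_mean s f : R := \int[mu]_y (f y * normal_pdf 0 s y).

Lemma gauss_integrable_le s f g : measurable_fun setT f ->
  (forall y, `|f y| <= `|g y|) -> gauss_integrable s g -> gauss_integrable s f.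
Proof.
move=> mf fg; apply: le_integrable => //.
  apply/measurable_EFinP/measurable_funM => //; exact: measurable_normal_pdf.
by move=> y _; rewrite lee_fin !normrM ler_wpM2r.
Qed.

Lemma gauss_integrable_cst s (c : R) : gauss_integrable s (fun=> c).
Proof.
rewrite /gauss_integrable (_ : _ \o _ = fun y => c%:E * (normal_pdf 0 s y)%:E)%E.
  by apply: integrableZl => //; exact: integrable_normal_pdf.
by apply/funext => y /=; rewrite EFinM.
Qed.

Lemma gauss_mean_cst s (c : R) : gauss_mean s (fun=> c) = c.
Proof.
rewrite /gauss_mean RintegralZl//; last exact: integrable_normal_pdf.
by rewrite /Rintegral integral_normal_pdf mulr1.
Qed.

Lemma gauss_integrableD s f g : gauss_integrable s f -> gauss_integrable s g ->
  gauss_integrable s (fun y => f y + g y).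
Proof.
move=> fi gi; have := integrableD measurableT fi gi; congr (_.-integrable _ _).
by apply/funext => y /=; rewrite mulrDl EFinD.
Qed.

Lemma gauss_meanD s f g : gauss_integrable s f -> gauss_integrable s g ->
  gauss_mean s (fun y => f y + g y) = gauss_mean s f + gauss_mean s g.
Proof.
move=> fi gi; rewrite /gauss_mean -RintegralD//.
by apply: eq_Rintegral => y _; rewrite mulrDl.
Qed.

Lemma gauss_integrableZ s (c : R) f : gauss_integrable s f ->
  gauss_integrable s (fun y => c * f y).
Proof.
move=> fi; have := integrableZl measurableT c fi; congr (_.-integrable _ _).
by apply/funext => y /=; rewrite -mulrA EFinM.
Qed.

Lemma gauss_meanZ s (c : R) f : gauss_integrable s f ->
  gauss_mean s (fun y => c * f y) = c * gauss_mean s f.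
Proof.
move=> fi; rewrite /gauss_mean -RintegralZl//.
by apply: eq_Rintegral => y _; rewrite mulrA.
Qed.

Lemma gauss_integrableB s f g : gauss_integrable s f -> gauss_integrable s g ->
  gauss_integrable s (fun y => f y - g y).
Proof.
move=> fi gi; have := gauss_integrableD fi (gauss_integrableZ (-1) gi).
by congr gauss_integrable; apply/funext => y; rewrite mulN1r.
Qed.

Lemma gauss_meanB s f g : gauss_integrable s f -> gauss_integrable s g ->
  gauss_mean s (fun y => f y - g y) = gauss_mean s f - gauss_mean s g.
Proof.
move=> fi gi; rewrite /gauss_mean -RintegralB//.
by apply: eq_Rintegral => y _; rewrite mulrBl.
Qed.

Lemma le_gauss_mean s f g : gauss_integrable s f -> gauss_integrable s g ->
  (forall y, f y <= g y) -> gauss_mean s f <= gauss_mean s g.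
Proof.
move=> fi gi fg; apply: le_Rintegral => // y _.
by rewrite ler_wpM2r ?normal_pdf_ge0.
Qed.

Lemma gauss_mean_le_norm s f g : gauss_integrable s f -> gauss_integrable s g ->
  (forall y, `|f y| <= g y) -> `|gauss_mean s f| <= gauss_mean s g.
Proof.
move=> fi gi fg; rewrite ler_norml; apply/andP; split.
  rewrite -mulN1r -gauss_meanZ//; apply: le_gauss_mean => //.
    exact: gauss_integrableZ.
  by move=> y; rewrite mulN1r; have := fg y; rewrite ler_norml => /andP[].
by apply: le_gauss_mean => // y; exact: le_trans (ler_norm _) (fg y).
Qed.

Lemma gauss_integrable_bounded s f (B : R) : measurable_fun setT f ->
  (forall y, `|f y| <= B) -> gauss_integrable s f.
Proof.
move=> mf fB; apply: (gauss_integrable_le mf _ (gauss_integrable_cst s B)) => y.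
exact: le_trans (fB y) (ler_norm _).
Qed.

Lemma gauss_mean_bounded s f (B : R) : measurable_fun setT f ->
  (forall y, `|f y| <= B) -> `|gauss_mean s f| <= B.
Proof.
move=> mf fB; rewrite -[leRHS](gauss_mean_cst s); apply: gauss_mean_le_norm => //.
  exact: gauss_integrable_bounded fB.
exact: gauss_integrable_cst.
Qed.

(** Completing the square: an exponential tilt by [u] moves the centre of the Gaussian to
    [u * s ^+ 2]. *)
Lemma normal_pdf_expR s u y : s != 0 ->
  expR (u * y) * normal_pdf 0 s y =
  expR (u ^+ 2 * s ^+ 2 / 2) * normal_pdf (u * s ^+ 2) s y.
Proof.
move=> s0; rewrite !normal_pdfE// /normal_fun !(mulrCA (expR _)) -!expRD.
by congr (_ * expR _); field.
Qed.

Lemma gauss_integrable_expR s u : s != 0 ->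
  gauss_integrable s (fun y => expR (u * y)).
Proof.
move=> s0; rewrite /gauss_integrable.
rewrite (_ : _ \o _ = fun y => (expR (u ^+ 2 * s ^+ 2 / 2))%:E *
   (normal_pdf (u * s ^+ 2) s y)%:E)%E.
  by apply: integrableZl => //; exact: integrable_normal_pdf.
by apply/funext => y /=; rewrite normal_pdf_expR// EFinM.
Qed.

Lemma gauss_mean_expR s u : s != 0 ->
  gauss_mean s (fun y => expR (u * y)) = expR (u ^+ 2 * s ^+ 2 / 2).
Proof.
move=> s0; rewrite /gauss_mean.
under eq_Rintegral do rewrite normal_pdf_expR//.
rewrite RintegralZl//; last exact: integrable_normal_pdf.
by rewrite /Rintegral integral_normal_pdf mulr1.
Qed.

(** After three terms the exponential series is [x ^+ 3] times a series bounded termwise by that of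
    [expR |x|], because [(i + 3)! >= i!]. *)
Lemma expR_taylor2 x : `|expR x - 1 - x - x ^+ 2 / 2| <= `|x| ^+ 3 * expR `|x|.
Proof.
have partial (N : nat) : `|series (exp_coeff x) (N + 3)%N - 1 - x - x ^+ 2 / 2|
    <= `|x| ^+ 3 * expR `|x|.
  rewrite /series /= [X in (X + 3)%N](_ : N = N - 0)%N ?subn0//.
  rewrite addnC big_nat_recl// big_nat_recl// big_nat_recl//.
  have -> : forall r : R, exp_coeff x 0 + (exp_coeff x 1 + (exp_coeff x 2 + r))
      - 1 - x - x ^+ 2 / 2 = r.
    move=> r; rewrite /exp_coeff /= !factS fact0 /= expr0 expr1.
    by rewrite !muln1 invr1 mulr1; ring.
  apply: le_trans (ler_norm_sum _ _ _) _.
  apply: (@le_trans _ _ (`|x| ^+ 3 * series (exp_coeff `|x|) N)).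
    rewrite /series /= mulr_sumr; apply: ler_sum => i _.
    rewrite /exp_coeff /= normrM normrV ?unitfE ?pnatr_eq0 -?lt0n ?fact_gt0//.
    rewrite normrX normr_nat mulrA -exprD addnC addn3 ler_wpM2l ?exprn_ge0//.
    rewrite lef_pV2 ?posrE ?ltr0n ?fact_gt0// ler_nat.
    by rewrite -addn3 leq_fact// leq_addr.
  rewrite ler_wpM2l ?exprn_ge0//; apply: nondecreasing_cvgn_le.
    move=> m n mn; rewrite /series /= -(subnK mn) addnC.
    rewrite /index_iota !subn0 iotaD big_cat/= lerDl sumr_ge0// => i _.
    by rewrite divr_ge0// exprn_ge0.
  exact: is_cvg_series_exp_coeff.
have cv : `|series (exp_coeff x) (N + 3)%N - 1 - x - x ^+ 2 / 2| @[N --> \oo]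
    --> `|expR x - 1 - x - x ^+ 2 / 2|.
  apply: cvg_norm; do 3! (apply: cvgB; last exact: cvg_cst).
  rewrite cvg_shiftn; exact: is_cvg_series_exp_coeff.
rewrite -(cvg_lim _ cv)//; apply: limr_le; first exact: cvgP cv.
by near=> n; exact: partial.
Unshelve. all: by end_near. Qed.

Lemma gauss_integrable_norm3 s : s != 0 ->
  gauss_integrable s (fun y => `|y| ^+ 3).
Proof.
move=> s0.
(* The [6] is 3!, from [z ^+ 3 / 3! <= expR z]; the two exponentials together dominate
   [expR |y|]. *)
apply: (@gauss_integrable_le _ _ (fun y => 6 * (expR (1 * y) + expR (-1 * y)))).
- by apply: measurable_funX => //; exact: measurableT_comp.
- move=> y; rewrite !mul1r mulN1r normrX normr_id [leRHS]ger0_norm; last first.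
    by rewrite mulr_ge0// addr_ge0// expR_ge0.
  have h (z : R) : 0 <= z -> z ^+ 3 <= 6 * expR z.
    move=> z0; rewrite -ler_pdivrMl// mulrC.
    have := expR_ge1Dxn 2 z0; rewrite /= (_ : (3`!)%:R = 6 :> R)//; lra.
  apply: le_trans (h _ (normr_ge0 _)) _; rewrite ler_wpM2l//.
  by have [y0|y0] := ger0P y; rewrite ?lerDl ?lerDr expR_ge0.
- apply: gauss_integrableZ.
  by apply: gauss_integrableD; exact: gauss_integrable_expR.
Qed.

Lemma gauss_integrable_sqr s : s != 0 -> gauss_integrable s (fun y => y ^+ 2).
Proof.
move=> s0; apply: (@gauss_integrable_le _ _ (fun y => 1 + `|y| ^+ 3)).
- exact: measurable_funX.
- move=> y; rewrite normrX [leRHS]ger0_norm ?addr_ge0 ?exprn_ge0//.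
  have := normr_ge0 y; move: `|y| => z z0.
  have : 0 <= (z - 1) ^+ 2 * (z + 1) by rewrite mulr_ge0 ?sqr_ge0// addr_ge0.
  nra.
- apply: gauss_integrableD; first exact: gauss_integrable_cst.
  exact: gauss_integrable_norm3.
Qed.

Lemma gauss_integrable_id s : s != 0 -> gauss_integrable s id.
Proof.
move=> s0; apply: (@gauss_integrable_le _ _ (fun y => 1 + y ^+ 2)) => //.
- move=> y; rewrite [leRHS]ger0_norm ?addr_ge0 ?sqr_ge0// -real_normK ?num_real//.
  have := normr_ge0 y; move: `|y| => z z0; nra.
- apply: gauss_integrableD; first exact: gauss_integrable_cst.
  exact: gauss_integrable_sqr.
Qed.

(** Combining the bounds for the two signs isolates [a * u] and [b * u ^+ 2]; a bound of order
    [u ^+ 3] near 0 then forces each coefficient to vanish. *)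
Lemma linear_quadratic_eq0 (a b C : R) :
  (forall u, 0 < u <= 1 -> `|a * u + b * u ^+ 2| <= C * u ^+ 3) ->
  (forall u, 0 < u <= 1 -> `|- (a * u) + b * u ^+ 2| <= C * u ^+ 3) ->
  a = 0 /\ b = 0.
Proof.
move=> h1 h2.
have C0 : 0 <= C.
  have := h1 1; rewrite ltr01 lexx !expr1n !mulr1 => /(_ isT) h.
  exact: le_trans (normr_ge0 _) h.
have small (c : R) : (forall u, 0 < u <= 1 -> `|c| <= C * u) -> c = 0.
  move=> h; apply/eqP; rewrite -normr_eq0; apply/eqP/le_anti.
  rewrite normr_ge0 andbT; apply/ler_addgt0Pr => e e0; rewrite add0r.
  have C1 : 0 < C + 1 by rewrite ltr_wpDl.
  have m0 : 0 < Num.min 1 (e / (C + 1)) by rewrite lt_min ltr01 divr_gt0.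
  have := h (Num.min 1 (e / (C + 1))); rewrite m0 ge_min lexx => /(_ isT) /le_trans.
  apply; apply: (@le_trans _ _ (C * (e / (C + 1)))).
    by rewrite ler_wpM2l// ge_min lexx orbT.
  by rewrite mulrA ler_pdivrMr// mulrC ler_pM2l// lerDl.
split; apply: small => u u01; have /andP[u0 u1] := u01;
  have := h1 u u01; have := h2 u u01; rewrite ![`|_ + _| <= _]ler_norml
  => /andP[p1 p2] /andP[q1 q2].
- have au : `|a| * u <= C * u ^+ 3.
    by rewrite -[X in _ * X]gtr0_norm// -normrM ler_norml; apply/andP; split; lra.
  have a2 : `|a| <= C * u ^+ 2 by rewrite -(ler_pM2r u0) -mulrA -exprSr.
  apply: le_trans a2 _; rewrite ler_wpM2l// expr2 ler_piMr//; exact: ltW.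
- have bu : `|b| * u ^+ 2 <= C * u ^+ 3.
    rewrite -[X in _ * X]ger0_norm ?sqr_ge0// -normrM ler_norml.
    by apply/andP; split; lra.
  by rewrite -(ler_pM2r (exprn_gt0 2 u0)) -mulrA -exprS.
Qed.

(* Comparing the expansions to order two in [u] of both sides of
   [E exp (u Y) = exp (u^2 s^2 / 2)] yields the first two moments. *)
Lemma gauss_mean_moments s : s != 0 ->
  gauss_mean s id = 0 /\ gauss_mean s (fun y => y ^+ 2) = s ^+ 2.
Proof.
move=> s0; set m1 := gauss_mean s id; set m2 := gauss_mean s _.
have i1 := gauss_integrable_id s0; have i2 := gauss_integrable_sqr s0.
(* An integrable majorant, independent of [u], of the Taylor remainder [|y| ^+ 3 * expR |y|]; the
   polynomial factor is paid for by one more exponential. *)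
pose g y := 6 * (expR (2 * y) + expR (-2 * y)) : R.
have ig : gauss_integrable s g.
  apply: gauss_integrableZ.
  by apply: gauss_integrableD; exact: gauss_integrable_expR.
pose K := gauss_mean s g.
have cubeE y : `|y| ^+ 3 * expR `|y| <= g y.
  have h (z : R) : 0 <= z -> z ^+ 3 * expR z <= 6 * expR (2 * z).
    move=> z0; rewrite (_ : 2 * z = z + z) ?expRD ?mulrA; last by ring.
    rewrite ler_wpM2r ?expR_ge0//.
    have := expR_ge1Dxn 2 z0; rewrite /= (_ : (3`!)%:R = 6 :> R)//; lra.
  apply: le_trans (h _ (normr_ge0 _)) _; rewrite /g ler_wpM2l//.
  by have [y0|y0] := ger0P y; rewrite ?mulrN ?mulNr ?lerDl ?lerDr expR_ge0.
(* [D] bounds what remains of [expR (u ^+ 2 * L)] beyond order two in [u]: terms in [u ^+ 4] and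
   [u ^+ 6], both at most [u ^+ 3] on the unit interval. *)
pose L := s ^+ 2 / 2 ; pose D := L ^+ 2 / 2 + L ^+ 3 * expR L.
have L0 : 0 <= L by rewrite divr_ge0 ?sqr_ge0.
(* [e] is the sign of the argument, so one computation serves both hypotheses of
   [linear_quadratic_eq0]. *)
have mgf (e u : R) : e ^+ 2 = 1 -> 0 < u <= 1 ->
    `|e * u * m1 + u ^+ 2 / 2 * m2 - u ^+ 2 * L| <= (K + D) * u ^+ 3.
  move=> e1 /andP[u0 u1].
  have ne : `|e| = 1.
    by apply/eqP; rewrite -(@eqrXn2 _ 2) ?expr1n ?real_normK ?num_real ?e1.
  have j0 := gauss_integrable_expR (e * u) s0.
  have j1 := gauss_integrableB j0 (gauss_integrable_cst s 1).
  have j2 := gauss_integrableB j1 (gauss_integrableZ (e * u) i1).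
  have j3 := gauss_integrableB j2 (gauss_integrableZ ((e * u) ^+ 2 / 2) i2).
  have : `|gauss_mean s (fun y => expR (e * u * y) - 1 - e * u * y
      - (e * u) ^+ 2 / 2 * y ^+ 2)| <= u ^+ 3 * K.
    rewrite -gauss_meanZ//; apply: gauss_mean_le_norm => //.
      exact: gauss_integrableZ.
    move=> y; rewrite (_ : _ / 2 * _ = (e * u * y) ^+ 2 / 2); last by rewrite !exprMn; ring.
    apply: le_trans (expR_taylor2 _) _.
    rewrite !normrM ne mul1r (gtr0_norm u0) exprMn -mulrA ler_wpM2l ?exprn_ge0 ?(ltW u0)//.
    apply: le_trans (cubeE y); rewrite ler_wpM2l ?exprn_ge0// ler_expR.
    by rewrite ler_piMl.
  rewrite (gauss_meanB j2 (gauss_integrableZ _ i2)).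
  rewrite (gauss_meanB j1 (gauss_integrableZ _ i1)).
  rewrite (gauss_meanB j0 (gauss_integrable_cst s 1)) gauss_mean_cst.
  rewrite (gauss_meanZ _ i1) (gauss_meanZ _ i2).
  rewrite gauss_mean_expR// exprMn e1 mul1r -mulrA -/L -/m1 -/m2 => h1.
  have h2 : `|expR (u ^+ 2 * L) - 1 - u ^+ 2 * L| <= D * u ^+ 3.
    have := expR_taylor2 (u ^+ 2 * L).
    rewrite [`|u ^+ 2 * L|]ger0_norm; last by rewrite mulr_ge0// sqr_ge0.
    rewrite [(u ^+ 2 * L) ^+ 2]exprMn [(u ^+ 2 * L) ^+ 3]exprMn => t2.
    have a1 : (u ^+ 2) ^+ 2 * L ^+ 2 / 2 <= u ^+ 3 * (L ^+ 2 / 2).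
      rewrite -mulrA ler_wpM2r ?divr_ge0 ?sqr_ge0//.
      by rewrite -exprM ler_wiXn2l// ltW.
    have a2 : (u ^+ 2) ^+ 3 * L ^+ 3 * expR (u ^+ 2 * L) <= u ^+ 3 * (L ^+ 3 * expR L).
      rewrite -mulrA; apply: ler_pM.
      - by rewrite !exprn_ge0// ltW.
      - by rewrite mulr_ge0 ?exprn_ge0 ?expR_ge0.
      - by rewrite -exprM ler_wiXn2l// ltW.
      - rewrite ler_wpM2l ?exprn_ge0// ler_expR ler_piMl//.
        by rewrite expr_le1// ltW.
    have a3 : 0 <= (u ^+ 2) ^+ 2 * L ^+ 2 / 2.
      by apply: divr_ge0 => //; apply: mulr_ge0; exact: sqr_ge0.
    move: t2; rewrite /D !ler_norml => /andP[t1 t2]; apply/andP; split; lra.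
  by move: h1 h2; rewrite !ler_norml => /andP[p1 p2] /andP[q1 q2]; apply/andP; split; lra.
have [] := @linear_quadratic_eq0 m1 (m2 / 2 - L) (K + D).
- move=> u u01; have := @mgf 1 u (expr1n _ _) u01.
  by congr (`|_| <= _); ring.
- move=> u u01; have := @mgf (-1) u _ u01; rewrite sqrrN expr1n => /(_ erefl).
  by congr (`|_| <= _); ring.
by move=> -> /eqP; rewrite /L -mulrBl mulf_eq0 invr_eq0 pnatr_eq0 orbF subr_eq0 => /eqP.
Qed.

End gaussian_mean.

(** * Scaling and convolution of Gaussian means *)

Section gaussian_convolution.
Context {R : realType}.
Implicit Types (a b c s x h : R) (f : R -> R).
Local Notation mu := (@lebesgue_measure R).

Lemma ge0_integral_affine (G : R -> R) c h : 0 < c -> continuous G ->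
  (forall x, 0 <= G x) ->
  (\int[mu]_x (G x)%:E = \int[mu]_x (c * G (c * x + h))%:E)%E.
Proof.
move=> c0 cG G0; pose F : R -> R := fun x => c * x + h.
have dF x : derivable F x 1 by [].
have F'E : F^`()%classic = cst c.
  apply/funext => x; rewrite /F derive1E deriveD// deriveM//.
  rewrite !derive_cst derive_id scaler0 !addr0 /GRing.scale /= mulr1//.
have -> : (fun x => (c * G (c * x + h))%:E) = fun x => (((G \o F) * F^`()%classic) x)%:E.
  by apply/funext => x; rewrite F'E /= mulrC.
apply: increasing_ge0_integration_by_substitutionT.
- by move=> x y xy; rewrite /F ltrD2r ltr_pM2l.
- by rewrite F'E => ?; exact: cvg_cst.
- by rewrite F'E; exact: is_cvg_cst.
- by rewrite F'E; exact: is_cvg_cst.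
- exact: dF.
- apply: (@cvg_comp _ _ _ ( *%R c) (+%R^~ h)) (cvg_addrr_Ny h).
  by apply: gt0_cvgMrNy.
- apply: (@cvg_comp _ _ _ ( *%R c) (+%R^~ h)) (cvg_addrr h).
  by apply: gt0_cvgMry.
- exact: cG.
- exact: G0.
Qed.

Lemma gauss_meanE s f : gauss_integrable s f ->
  ((gauss_mean s f)%:E = \int[mu]_y (f y * normal_pdf 0 s y)%:E)%E.
Proof. by move=> fi; rewrite /gauss_mean /Rintegral fineK// integrable_fin_num. Qed.

Lemma normal_pdf_scale c s x : 0 < c -> s != 0 ->
  c * normal_pdf 0 (c * s) (c * x) = normal_pdf 0 s x.
Proof.
move=> c0 s0; have cs0 : c * s != 0 by rewrite mulf_neq0// gt_eqF.
rewrite !normal_pdfE//= mulrA; congr (_ * _).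
  rewrite /normal_peak exprMn -mulrA -mulrnAr sqrtrM ?sqr_ge0// sqrtr_sqr gtr0_norm//.
  by rewrite invfM mulrA divff ?mul1r ?gt_eqF.
by rewrite /normal_fun; congr expR; field; rewrite s0 gt_eqF.
Qed.

Lemma cts_gauss_integrable s f (B : R) : continuous f -> (forall y, `|f y| <= B) ->
  gauss_integrable s f.
Proof.
move=> cf; apply: gauss_integrable_bounded; exact: continuous_measurable_fun.
Qed.

Lemma ge0_gauss_mean_scale c s f (B : R) : 0 < c -> s != 0 -> continuous f ->
  (forall y, 0 <= f y <= B) ->
  gauss_mean (c * s) f = gauss_mean s (fun y => f (c * y)).
Proof.
move=> c0 s0 cf fB; have cs0 : c * s != 0 by rewrite mulf_neq0// gt_eqF.
apply: (congr1 fine).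
rewrite (@ge0_integral_affine _ c 0 c0).
- apply: eq_integral => x _; rewrite addr0; congr EFin.
  by rewrite mulrCA normal_pdf_scale.
- by move=> x; apply: cvgM; [exact: cf|exact: continuous_normal_pdf].
- by move=> x; rewrite mulr_ge0 ?normal_pdf_ge0//; case/andP: (fB x).
Qed.

(** Adding its bound makes a function nonnegative, and [gauss_mean] preserves constants; this
    carries scaling and convolution from nonnegative functions, where Tonelli and substitution need
    no integrability, to signed ones. *)
Lemma shift_bounded f (B : R) : (forall y, `|f y| <= B) ->
  forall y, 0 <= f y + B <= B + B.
Proof.
move=> fB y; have := fB y; rewrite ler_norml => /andP[? ?].
by rewrite lerD2r -lerBlDr sub0r; apply/andP.
Qed.

Lemma gauss_mean_scale c s f (B : R) : 0 < c -> s != 0 -> continuous f ->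
  (forall y, `|f y| <= B) ->
  gauss_mean (c * s) f = gauss_mean s (fun y => f (c * y)).
Proof.
move=> c0 s0 cf fB.
have := @ge0_gauss_mean_scale c s (fun y => f y + B) (B + B) c0 s0.
rewrite !gauss_meanD ?gauss_mean_cst; first last.
- exact: gauss_integrable_cst.
- exact: (@cts_gauss_integrable _ _ B).
- exact: gauss_integrable_cst.
- apply: (@cts_gauss_integrable _ _ B) => // x.
  by apply: continuous_comp; [exact: mulrl_continuous|exact: cf].
move=> H; apply: (addIr B); apply: H; last exact: shift_bounded.
by move=> x; apply: cvgD; [exact: cf|exact: cvg_cst].
Qed.

(** The joint density of one summand and the sum, factored as the density of the sum times the
    conditional density of the summand given the sum. *)
Lemma normal_pdf_convolution a b c x z : 0 < a -> 0 < b -> 0 < c ->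
  c ^+ 2 = a ^+ 2 + b ^+ 2 ->
  normal_pdf 0 b (z - x) * normal_pdf 0 a x =
  normal_pdf 0 c z * normal_pdf (a ^+ 2 * z / c ^+ 2) (a * b / c) x.
Proof.
move=> a0 b0 c0 cE.
have an0 : a != 0 by rewrite gt_eqF.
have bn0 : b != 0 by rewrite gt_eqF.
have cn0 : c != 0 by rewrite gt_eqF.
rewrite !normal_pdfE//=; last by rewrite !mulf_neq0 ?invr_neq0.
rewrite mulrACA [RHS]mulrACA; congr (_ * _).
  rewrite /normal_peak -!invfM -!sqrtrM; first last.
  - by rewrite mulrn_wge0// mulr_ge0 ?sqr_ge0 ?pi_ge0.
  - by rewrite mulrn_wge0// mulr_ge0 ?sqr_ge0 ?pi_ge0.
  by congr (Num.sqrt _)^-1; field.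
rewrite /normal_fun -!expRD; congr expR.
have c2 : a ^+ 2 + b ^+ 2 != 0 by rewrite -cE expf_neq0.
rewrite !expr_div_n exprMn cE; field.
by rewrite an0 bn0 c2.
Qed.

Lemma continuous_shift f x : continuous f -> continuous (fun y => f (x + y)).
Proof.
move=> cf y; apply: (@continuous_comp _ _ _ (+%R x)); last exact: cf.
by apply: cvgD; [exact: cvg_cst|exact: cvg_id].
Qed.

Lemma ge0_gauss_mean_convolution a b c f (B : R) :
  0 < a -> 0 < b -> 0 < c -> c ^+ 2 = a ^+ 2 + b ^+ 2 ->
  continuous f -> (forall y, 0 <= f y <= B) ->
  gauss_mean a (fun x => gauss_mean b (fun y => f (x + y))) = gauss_mean c f.
Proof.
move=> a0 b0 c0 cE cf fB.
have an0 : a != 0 by rewrite gt_eqF.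
have bn0 : b != 0 by rewrite gt_eqF.
have cn0 : c != 0 by rewrite gt_eqF.
have f0 y : 0 <= f y by have /andP[] := fB y.
have fB' y : `|f y| <= B by case/andP: (fB y) => ? fyB; rewrite ger0_norm.
have cfD x := @continuous_shift f x cf.
have mf := continuous_measurable_fun cf.
apply: (congr1 fine).
(* The integrand after the substitution [z = x + y]. Once the integrals are exchanged, the inner one
   is over a conditional density and equals 1. *)
pose g (p : R * R) : \bar R :=
  (f p.2 * (normal_pdf 0 b (p.2 - p.1) * normal_pdf 0 a p.1))%:E.
transitivity (\int[mu]_x \int[mu]_z g (x, z))%E.
  apply: eq_integral => x _; rewrite EFinM gauss_meanE; last first.
    by apply: (@cts_gauss_integrable _ _ B).
  rewrite (@ge0_integral_affine _ 1 (- x))//; first last.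
  - by move=> y; rewrite mulr_ge0 ?normal_pdf_ge0.
  - by move=> y; apply: cvgM; [exact: cfD|exact: continuous_normal_pdf].
  rewrite -ge0_integralZr//; first last.
  - by rewrite lee_fin normal_pdf_ge0.
  - by move=> y _; rewrite lee_fin !mulr_ge0 ?normal_pdf_ge0.
  - apply/measurable_EFinP/measurable_funM => //; apply: measurable_funM => /=.
      apply: measurableT_comp => //.
      by apply: measurable_funD => //; apply: measurable_funD => //; apply: measurable_funM.
    apply: measurableT_comp; first exact: measurable_normal_pdf.
    by apply: measurable_funD => //; apply: measurable_funM.
  apply: eq_integral => z _; rewrite /g /= -EFinM !mul1r addrC subrK.
  by rewrite mulrA.
rewrite fubini_tonelli//; first last.
- by move=> p; rewrite lee_fin !mulr_ge0 ?normal_pdf_ge0.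
- apply/measurable_EFinP/measurable_funM.
    exact: measurableT_comp.
  apply: measurable_funM.
    apply: measurableT_comp; first exact: measurable_normal_pdf.
    exact: measurable_funB.
  by apply: measurableT_comp; first exact: measurable_normal_pdf.
apply: eq_integral => z _; rewrite /g /=.
under eq_integral do rewrite (normal_pdf_convolution _ _ a0 b0 c0 cE) mulrA EFinM.
rewrite ge0_integralZl//.
- by rewrite integral_normal_pdf mule1.
- apply/measurable_EFinP; exact: measurable_normal_pdf.
- by move=> y _; rewrite lee_fin normal_pdf_ge0.
- by rewrite lee_fin mulr_ge0 ?normal_pdf_ge0.
Qed.

Lemma gauss_mean_convolution a b c f (B : R) :
  0 < a -> 0 < b -> 0 < c -> c ^+ 2 = a ^+ 2 + b ^+ 2 ->
  continuous f -> (forall y, `|f y| <= B) ->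
  gauss_integrable a (fun x => gauss_mean b (fun y => f (x + y))) ->
  gauss_mean a (fun x => gauss_mean b (fun y => f (x + y))) = gauss_mean c f.
Proof.
move=> a0 b0 c0 cE cf fB iab.
have cfD x := @continuous_shift f x cf.
have ifD x : gauss_integrable b (fun y => f (x + y)).
  by apply: (@cts_gauss_integrable _ _ B).
have E : (fun x => gauss_mean b (fun y => f (x + y) + B)) =
    fun x => gauss_mean b (fun y => f (x + y)) + B.
  apply/funext => x; rewrite gauss_meanD ?gauss_mean_cst//.
  exact: gauss_integrable_cst.
have := @ge0_gauss_mean_convolution a b c (fun y => f y + B) (B + B) a0 b0 c0 cE.
rewrite E (gauss_meanD iab (gauss_integrable_cst _ _)) gauss_mean_cst.
rewrite gauss_meanD ?gauss_mean_cst; first last.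
- exact: gauss_integrable_cst.
- exact: (@cts_gauss_integrable _ _ B).
move=> H; apply: (addIr B); apply: H; last exact: shift_bounded.
by move=> x; apply: cvgD; [exact: cf|exact: cvg_cst].
Qed.

End gaussian_convolution.

(** * Smooth test functions *)

Section smooth_class.
Context {R : realType}.
Implicit Types (f g : R -> R) (M s x h : R).

Definition tame f := exists B : R,
  (forall x, `|f x| <= B) /\ (forall x y, `|f x - f y| <= B * `|x - y|).

(* A class of twice differentiable functions with derivatives [f1], [f2],
   described by Taylor remainders so that it is visibly stable under averaging;
   [M] plays the role of a bound on the third derivative. *)
Definition taylor2 M f f1 f2 := [/\
  forall x h, `|f (x + h) - f x - h * f1 x - h ^+ 2 / 2 * f2 x| <= M * `|h| ^+ 3,
  forall x h, `|f1 (x + h) - f1 x - h * f2 x| <= M * h ^+ 2 &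
  forall x h, `|f2 (x + h) - f2 x| <= M * `|h|].

Definition tame_taylor2 M f f1 f2 :=
  [/\ taylor2 M f f1 f2, tame f, tame f1 & tame f2].

Lemma tame_continuous f : tame f -> continuous f.
Proof.
move=> [B [fB fL]] x; apply/(@cvgrPdist_le _ R^o) => e e0.
have B0 : 0 < B + 1.
  by rewrite ltr_wpDl// (le_trans _ (fB 0)).
near=> y.
apply: le_trans (fL _ _) _.
apply: (@le_trans _ _ ((B + 1) * `|x - y|)); first by rewrite ler_wpM2r// lerDl.
rewrite mulrC -ler_pdivlMr//.
by near: y; apply: (@cvgr_dist_le _ R^o _ _ _ id x) => //; rewrite divr_gt0.
Unshelve. all: by end_near. Qed.

Lemma tame_shift f x : tame f -> tame (fun y => f (x + y)).
Proof.
move=> [B [fB fL]]; exists B; split => // y z.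
by rewrite (le_trans (fL _ _))// opprD addrACA subrr add0r.
Qed.

Lemma tame_gauss_integrable s f : tame f -> gauss_integrable s f.
Proof.
move=> tf; have [B [fB _]] := tf.
by apply: cts_gauss_integrable fB; exact: tame_continuous.
Qed.

Lemma tame_gauss_mean s f : tame f -> tame (fun x => gauss_mean s (fun y => f (x + y))).
Proof.
move=> tf; have [B [fB fL]] := tf; exists B; split => [x|x y].
  apply: gauss_mean_bounded => //.
  by apply: continuous_measurable_fun; exact/continuous_shift/tame_continuous.
rewrite -gauss_meanB; try exact/tame_gauss_integrable/tame_shift.
rewrite -[leRHS](gauss_mean_cst s); apply: gauss_mean_le_norm.
- by apply: gauss_integrableB; exact/tame_gauss_integrable/tame_shift.
- exact: gauss_integrable_cst.
- by move=> z; rewrite (le_trans (fL _ _))// [z in _ - z]addrC addrKA.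
Qed.

Lemma taylor2_shift M f f1 f2 x : tame_taylor2 M f f1 f2 ->
  tame_taylor2 M (fun y => f (x + y)) (fun y => f1 (x + y)) (fun y => f2 (x + y)).
Proof.
move=> [[h0 h1 h2] t0 t1 t2]; split; try exact: tame_shift.
by split => y h; rewrite addrA.
Qed.

(** The remainder bounds are uniform in the base point, so they can simply be averaged; nothing is
    differentiated under the integral. *)
Lemma taylor2_gauss_mean M f f1 f2 s : tame_taylor2 M f f1 f2 ->
  tame_taylor2 M (fun x => gauss_mean s (fun y => f (x + y)))
    (fun x => gauss_mean s (fun y => f1 (x + y)))
    (fun x => gauss_mean s (fun y => f2 (x + y))).
Proof.
move=> [[h0 h1 h2] t0 t1 t2]; split; try exact: tame_gauss_mean.
have i0 x := tame_gauss_integrable s (tame_shift x t0).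
have i1 x := tame_gauss_integrable s (tame_shift x t1).
have i2 x := tame_gauss_integrable s (tame_shift x t2).
split => x h; rewrite -?gauss_meanZ// -[leRHS](gauss_mean_cst s).
- have j1 := gauss_integrableB (i0 (x + h)) (i0 x).
  have j2 := gauss_integrableB j1 (gauss_integrableZ h (i1 x)).
  have j3 := gauss_integrableB j2 (gauss_integrableZ (h ^+ 2 / 2) (i2 x)).
  rewrite -(gauss_meanB (i0 _) (i0 x)) -(gauss_meanB j1 (gauss_integrableZ h (i1 x))).
  rewrite -(gauss_meanB j2 (gauss_integrableZ (h ^+ 2 / 2) (i2 x))).
  apply: gauss_mean_le_norm => //; first exact: gauss_integrable_cst.
  by move=> y; rewrite [x + h + y]addrAC.
- have j1 := gauss_integrableB (i1 (x + h)) (i1 x).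
  have j2 := gauss_integrableB j1 (gauss_integrableZ h (i2 x)).
  rewrite -(gauss_meanB (i1 _) (i1 x)) -(gauss_meanB j1 (gauss_integrableZ h (i2 x))).
  apply: gauss_mean_le_norm => //; first exact: gauss_integrable_cst.
  by move=> y; rewrite [x + h + y]addrAC.
- have j1 := gauss_integrableB (i2 (x + h)) (i2 x).
  rewrite -(gauss_meanB (i2 _) (i2 x)).
  apply: gauss_mean_le_norm => //; first exact: gauss_integrable_cst.
  by move=> y; rewrite [x + h + y]addrAC.
Qed.

Lemma taylor2_ge0 M f f1 f2 : taylor2 M f f1 f2 -> 0 <= M.
Proof. by case=> _ _ /(_ 0 1); rewrite normr1 mulr1; exact: le_trans. Qed.

Lemma norm_le1Dsqr x : `|x| <= 1 + x ^+ 2.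
Proof. by rewrite -real_normK ?num_real//; have := normr_ge0 x; nra. Qed.

Lemma gauss_mean_taylor0 M f f1 f2 s : s != 0 -> tame_taylor2 M f f1 f2 ->
  `|gauss_mean s f - f 0 - s ^+ 2 / 2 * f2 0| <= gauss_mean s (fun y => `|y| ^+ 3) * M.
Proof.
move=> s0 [[h0 h1 h2] t0 t1 t2]; have [m1 m2] := gauss_mean_moments s0.
have i0 := tame_gauss_integrable s t0; have ic := gauss_integrable_cst s (f 0).
have i1 := gauss_integrableZ (f1 0) (gauss_integrable_id s0).
have i2 := gauss_integrableZ (f2 0 / 2) (gauss_integrable_sqr s0).
have j1 := gauss_integrableB i0 ic; have j2 := gauss_integrableB j1 i1.
have j3 := gauss_integrableB j2 i2.
rewrite [leRHS]mulrC -gauss_meanZ; last exact: gauss_integrable_norm3.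
have -> : gauss_mean s f - f 0 - s ^+ 2 / 2 * f2 0 =
    gauss_mean s (fun y => f y - f 0 - f1 0 * y - f2 0 / 2 * y ^+ 2).
  rewrite (gauss_meanB j2 i2) (gauss_meanB j1 i1) (gauss_meanB i0 ic).
  rewrite (gauss_meanZ _ (gauss_integrable_id s0)).
  by rewrite (gauss_meanZ _ (gauss_integrable_sqr s0)) gauss_mean_cst m1 m2; ring.
apply: gauss_mean_le_norm => //.
  by apply: gauss_integrableZ; exact: gauss_integrable_norm3.
by move=> y; have := h0 0 y; rewrite add0r; congr (`|_| <= _); ring.
Qed.

Lemma gauss_mean_taylor1 M f f1 f2 s : s != 0 -> tame_taylor2 M f f1 f2 ->
  `|gauss_mean s f1 - f1 0| <= M * s ^+ 2.
Proof.
move=> s0 [[h0 h1 h2] t0 t1 t2]; have [m1 m2] := gauss_mean_moments s0.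
have i0 := tame_gauss_integrable s t1; have ic := gauss_integrable_cst s (f1 0).
have i1 := gauss_integrableZ (f2 0) (gauss_integrable_id s0).
have j1 := gauss_integrableB i0 ic; have j2 := gauss_integrableB j1 i1.
rewrite -m2 -gauss_meanZ; last exact: gauss_integrable_sqr.
have -> : gauss_mean s f1 - f1 0 = gauss_mean s (fun y => f1 y - f1 0 - f2 0 * y).
  rewrite (gauss_meanB j1 i1) (gauss_meanB i0 ic).
  by rewrite (gauss_meanZ _ (gauss_integrable_id s0)) gauss_mean_cst m1; ring.
apply: gauss_mean_le_norm => //.
  by apply: gauss_integrableZ; exact: gauss_integrable_sqr.
by move=> y; have := h1 0 y; rewrite add0r mulrC; congr (`|_| <= _); ring.
Qed.

(** Trading [|y|] for [1 + y ^+ 2] avoids the first absolute moment; the bound is affine in the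
    variance, a growth that the recursion can absorb. *)
Lemma gauss_mean_taylor2 M f f1 f2 s : s != 0 -> tame_taylor2 M f f1 f2 ->
  `|gauss_mean s f2 - f2 0| <= M * (1 + s ^+ 2).
Proof.
move=> s0 [T t0 t1 t2]; have [m1 m2] := gauss_mean_moments s0.
have [h0 h1 h2] := T; have M0 := taylor2_ge0 T.
have i0 := tame_gauss_integrable s t2; have ic := gauss_integrable_cst s (f2 0).
have i1 := gauss_integrableD (gauss_integrable_cst s 1) (gauss_integrable_sqr s0).
have -> : 1 + s ^+ 2 = gauss_mean s (fun y => 1 + y ^+ 2).
  rewrite gauss_meanD ?gauss_mean_cst ?m2//; first exact: gauss_integrable_cst.
  exact: gauss_integrable_sqr.
rewrite -gauss_meanZ// -[f2 0 in leLHS](gauss_mean_cst s) -gauss_meanB//.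
apply: gauss_mean_le_norm.
- exact: gauss_integrableB.
- exact: gauss_integrableZ.
- move=> y; have := h2 0 y; rewrite add0r => /le_trans; apply.
  by rewrite ler_wpM2l// norm_le1Dsqr.
Qed.

End smooth_class.

(** * Additive recursions *)

Section mean_functional.
Context {R : realType}.
Implicit Types (L : (R -> R) -> R) (f g : R -> R).

(* Models expectation under a finitely supported law, hence defined on all
   functions. *)
Record mean_functional L : Prop := MeanFunctional {
  meanD : forall f g, L (fun x => f x + g x) = L f + L g;
  meanZ : forall c f, L (fun x => c * f x) = c * L f;
  mean_cst : forall c, L (fun=> c) = c;
  mean_ge0 : forall f, (forall x, 0 <= f x) -> 0 <= L f }.

Variables (L : (R -> R) -> R) (Lm : mean_functional L).

Lemma meanN f : L (fun x => - f x) = - L f.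
Proof. by rewrite -mulN1r -(meanZ Lm); congr L; apply/funext => x; rewrite mulN1r. Qed.

Lemma meanB f g : L (fun x => f x - g x) = L f - L g.
Proof. by rewrite (meanD Lm) meanN. Qed.

Lemma le_mean f g : (forall x, f x <= g x) -> L f <= L g.
Proof.
by move=> fg; rewrite -subr_ge0 -meanB; apply: (mean_ge0 Lm) => x; rewrite subr_ge0.
Qed.

Lemma mean_le_norm f g : (forall x, `|f x| <= g x) -> `|L f| <= L g.
Proof.
move=> fg; rewrite ler_norml -meanN; apply/andP; split; apply: le_mean => x;
  by have := fg x; rewrite ler_norml => /andP[].
Qed.

Lemma mean_le_cst f c : (forall x, `|f x| <= c) -> `|L f| <= c.
Proof. by move=> fc; rewrite -[leRHS](mean_cst Lm); exact: mean_le_norm. Qed.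

(** No moment is prescribed, because at small indices the first two are arbitrary; their terms
    reappear as the corrections in [defect]. *)
Lemma mean_taylor0 M f f1 f2 : taylor2 M f f1 f2 ->
  `|L f - f 0 - L id * f1 0 - L (fun x => x ^+ 2) / 2 * f2 0|
    <= L (fun x => `|x| ^+ 3) * M.
Proof.
move=> [h0 _ _]; rewrite [leRHS]mulrC -(meanZ Lm).
have -> : L f - f 0 - L id * f1 0 - L (fun x => x ^+ 2) / 2 * f2 0 =
    L (fun x => f x - f 0 - f1 0 * x - f2 0 / 2 * x ^+ 2).
  by rewrite !meanB !(meanZ Lm) (mean_cst Lm); ring.
by apply: mean_le_norm => x; have := h0 0 x; rewrite add0r; congr (`|_| <= _); ring.
Qed.

Lemma mean_taylor1 M f f1 f2 : taylor2 M f f1 f2 -> L id = 0 ->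
  `|L f1 - f1 0| <= M * L (fun x => x ^+ 2).
Proof.
move=> [_ h1 _] m0; rewrite -(meanZ Lm).
have -> : L f1 - f1 0 = L (fun x => f1 x - f1 0 - f2 0 * x).
  by rewrite !meanB (meanZ Lm) (mean_cst Lm) m0; ring.
by apply: mean_le_norm => x; have := h1 0 x; rewrite add0r; congr (`|_| <= _); ring.
Qed.

Lemma mean_taylor2 M f f1 f2 : taylor2 M f f1 f2 ->
  `|L f2 - f2 0| <= M * (1 + L (fun x => x ^+ 2)).
Proof.
move=> T; have [_ _ h2] := T; have M0 := taylor2_ge0 T.
have -> : 1 + L (fun x => x ^+ 2) = L (fun x => 1 + x ^+ 2).
  by rewrite (meanD Lm) (mean_cst Lm).
rewrite -(meanZ Lm).
rewrite -[f2 0 in leLHS](mean_cst Lm) -meanB; apply: mean_le_norm => x.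
have := h2 0 x; rewrite add0r => /le_trans; apply.
by rewrite ler_wpM2l// norm_le1Dsqr.
Qed.

End mean_functional.

Section linear_recursion.
Context {R : realType}.
Implicit Types (a : nat -> R).

Lemma sum_succ (n : nat) : \sum_(j < n) (j.+1%:R : R) = n%:R * (n%:R + 1) / 2.
Proof.
elim: n => [|n IH]; first by rewrite big_ord0 !mul0r.
by rewrite big_ord_recr /= IH -natr1; field.
Qed.

Lemma sum_rev_ord a (n : nat) : \sum_(j < n) a (n - 1 - j)%N = \sum_(j < n) a j.
Proof.
rewrite (reindex_inj rev_ord_inj) /=; apply: eq_bigr => j _; congr a.
by have := ltn_ord j; lia.
Qed.

(** The slope for which [slope * (j + 1)] has the same sum over [j < N] as [a]. *)
Definition recursion_slope a (N : nat) : R :=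
  2 * (\sum_(j < N) a j) / (N%:R * (N%:R + 1)).

(** The recursion sees earlier terms only through their sum, which gets multiplied by [1 + 2 / n] at
    each step and is thus proportional to [n * (n + 1)] from [N] on. *)
Lemma linear_recursion a (N : nat) : (0 < N)%N ->
  (forall n, (N <= n)%N -> n%:R * a n = 2 * \sum_(j < n) a j) ->
  forall n, (N <= n)%N ->
    \sum_(j < n) a j = recursion_slope a N * (n%:R * (n%:R + 1) / 2) /\
    a n = recursion_slope a N * n.+1%:R.
Proof.
move=> N0 rec n Nn; have E : \sum_(j < n) a j =
    recursion_slope a N * (n%:R * (n%:R + 1) / 2).
  elim: n Nn => [|n IH]; first by rewrite leqn0 => /eqP NE; rewrite NE in N0.
  have pos m : (0 < m)%N -> (m%:R : R) != 0 by rewrite pnatr_eq0 -lt0n.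
  have pos1 m : (m%:R + 1 : R) != 0 by rewrite natr1 pnatr_eq0.
  rewrite leq_eqVlt => /orP[/eqP <-|].
    by rewrite /recursion_slope; field; rewrite pos1 pos.
  rewrite ltnS => Nn; have n0 : (0 < n)%N by lia.
  have := rec n Nn; rewrite big_ord_recr /= (IH Nn) => h.
  by apply: (mulfI (pos n n0)); rewrite mulrDr h -natr1; field.
have n0 : n%:R != 0 :> R by rewrite pnatr_eq0 -lt0n (leq_trans N0).
by split=> //; apply: (mulfI n0); rewrite rec// E -natr1; field.
Qed.

End linear_recursion.

(** * Gaussian approximation for laws that are mixtures of convolutions *)

Section additive_recursion.
Context {R : realType}.
Variables (L : nat -> (R -> R) -> R) (N : nat) (v : R).
Hypothesis Lm : forall n, mean_functional (L n).
Hypothesis Lrec : forall n, (N <= n)%N -> forall f : R -> R,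
  n%:R * L n f = \sum_(j < n) L j (fun x => L (n - 1 - j) (fun y => f (x + y))).
Hypothesis v0 : 0 < v.
Hypothesis N0 : (0 < N)%N.

Local Notation m j := (L j id).
Local Notation s j := (L j (fun x => x ^+ 2)).
Local Notation tau j := (Num.sqrt (v * j.+1%:R)).

Hypothesis m0 : forall n, (N <= n)%N -> m n = 0 /\ \sum_(j < n) m j = 0.
Hypothesis sv : forall n, (N <= n)%N ->
  s n = v * n.+1%:R /\ \sum_(j < n) s j = v * (n%:R * (n%:R + 1) / 2).

Let delta j := s j - v * j.+1%:R.

Let tau_gt0 j : 0 < tau j. Proof. by rewrite sqrtr_gt0 mulr_gt0. Qed.
Let tau_neq0 j : tau j != 0. Proof. by rewrite gt_eqF. Qed.
Let sqr_tau j : tau j ^+ 2 = v * j.+1%:R.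
Proof. by rewrite sqr_sqrtr// mulr_ge0// ltW. Qed.

(** Subtracting the mismatch of the first two moments leaves an error of third order at every index;
    for [j >= N] both corrections are 0. *)
Let defect j (f f1 f2 : R -> R) := L j f - gauss_mean (tau j) f - m j * f1 0 - delta j / 2 * f2 0.

Let close j e := forall M f f1 f2, tame_taylor2 M f f1 f2 ->
  `|defect j f f1 f2| <= e * M.

Let e0 j := L j (fun x => `|x| ^+ 3) + gauss_mean (tau j) (fun y => `|y| ^+ 3).

Let e0_ge0 j : 0 <= e0 j.
Proof.
rewrite addr_ge0//; first by apply: (mean_ge0 (Lm j)) => x; rewrite exprn_ge0.
by apply: Rintegral_ge0 => y _; rewrite mulr_ge0 ?exprn_ge0 ?normal_pdf_ge0.
Qed.

Let close_e0 j : close j (e0 j).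
Proof.
move=> M f f1 f2 T; have [T' _ _ _] := T.
have := mean_taylor0 (Lm j) T'; have := gauss_mean_taylor0 (tau_neq0 j) T.
rewrite sqr_tau /e0 mulrDl => h1 h2; apply: le_trans (lerD h2 h1).
apply: le_trans _ (ler_normB _ _).
by rewrite le_eqVlt; apply/orP; left; apply/eqP; congr (`|_|); rewrite /defect /delta; ring.
Qed.

(** The cost, in units of [n * M], of evaluating the corrections of index [j] at 0 instead of
    averaging them over the other summand. The weights [v] and [1 + v] come from the first and
    second derivative bounds. *)
Let c j := `|m j| * v + `|delta j| / 2 * (1 + v).

Let c_ge0 j : 0 <= c j.
Proof.
have v0' := ltW v0; rewrite addr_ge0//; first exact: mulr_ge0.
by rewrite mulr_ge0 ?addr_ge0// divr_ge0.
Qed.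

Let c_eq0 j : (N <= j)%N -> c j = 0.
Proof.
by move=> Nj; rewrite /c /delta (m0 Nj).1 (sv Nj).1 subrr normr0 !mul0r addr0.
Qed.

Let normM_le (x y z : R) : `|y| <= z -> `|x * y| <= `|x| * z.
Proof. by move=> yz; rewrite normrM ler_wpM2l. Qed.

Let linear_le M (n k : nat) (z : R) : 0 <= M -> (k < n)%N ->
  `|z| <= M * (v * k.+1%:R) -> `|z| <= v * n%:R * M.
Proof.
move=> M0 kn /le_trans; apply; rewrite [leRHS]mulrC ler_wpM2l//.
by rewrite ler_wpM2l ?(ltW v0)// ler_nat.
Qed.

Let affine_le M (n k : nat) (z : R) : 0 <= M -> (k < n)%N ->
  `|z| <= M * (1 + v * k.+1%:R) -> `|z| <= n%:R * (1 + v) * M.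
Proof.
move=> M0 kn /le_trans; apply; rewrite [leRHS]mulrC ler_wpM2l// mulrDr mulr1.
rewrite lerD ?ler1n//; first exact: leq_ltn_trans kn.
by rewrite [leRHS]mulrC ler_wpM2l ?(ltW v0)// ler_nat.
Qed.

(** The two indices add up to [n - 1 >= 2 * N - 1], so one of them is at least [N]: either the
    mismatches at [n - 1 - j] vanish, or [L j] has the exact moments that control [f1] and [f2]. *)
Let edge_le n j M f f1 f2 : (2 * N <= n)%N -> (j < n)%N -> taylor2 M f f1 f2 ->
  `|m (n - 1 - j) * (L j f1 - f1 0)| <= `|m (n - 1 - j)| * (v * n%:R * M) /\
  `|delta (n - 1 - j) / 2 * (L j f2 - f2 0)| <=
    `|delta (n - 1 - j) / 2| * (n%:R * (1 + v) * M).
Proof.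
move=> Nn jn T; have M0 := taylor2_ge0 T; have [Ni|iN] := leqP N (n - 1 - j).
  by rewrite /delta (m0 Ni).1 (sv Ni).1 subrr !(mul0r, normr0).
have Nj : (N <= j)%N by lia.
split; apply: normM_le.
  apply: (linear_le M0 jn); rewrite -(sv Nj).1.
  exact: (mean_taylor1 (Lm j) T (m0 Nj).1).
apply: (affine_le M0 jn); rewrite -(sv Nj).1.
exact: (mean_taylor2 (Lm j) T).
Qed.

Let close_conv n j e e' M f f1 f2 : (2 * N <= n)%N -> (j < n)%N ->
  close j e -> close (n - 1 - j) e' -> tame_taylor2 M f f1 f2 ->
  `|L j (fun x => L (n - 1 - j) (fun y => f (x + y))) - gauss_mean (tau n) f
    - (m j + m (n - 1 - j)) * f1 0 - (delta j + delta (n - 1 - j)) / 2 * f2 0|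
  <= (e + e' + n%:R * (c j + c (n - 1 - j))) * M.
Proof.
move=> Nn jn; set i := (n - 1 - j)%N => cj ci T.
have [T' t0 t1 t2] := T; have M0 := taylor2_ge0 T'.
have in_ : (i < n)%N by rewrite /i; lia.
pose g x := gauss_mean (tau i) (fun y => f (x + y)).
pose g1 x := gauss_mean (tau i) (fun y => f1 (x + y)).
pose g2 x := gauss_mean (tau i) (fun y => f2 (x + y)).
have Tg : tame_taylor2 M g g1 g2 by exact: taylor2_gauss_mean.
(* First exchange: for fixed [x] the inner law becomes Gaussian, with [f] shifted by [x]. The
   corrections then come out averaged over [L j]. *)
have a1 : `|L j (fun x => L i (fun y => f (x + y))) - L j g - m i * L j f1
    - delta i / 2 * L j f2| <= e' * M.
  rewrite -!(meanZ (Lm j)) -!(meanB (Lm j)); apply: (mean_le_cst (Lm j)) => x.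
  by have := ci _ _ _ _ (taylor2_shift x T); rewrite /defect addr0.
have a2 := cj _ _ _ _ Tg; rewrite /defect in a2.
(* After the second exchange both summands are Gaussian, and their variances add since
   [j.+1 + i.+1 = n.+1]. *)
have gE : gauss_mean (tau j) g = gauss_mean (tau n) f.
  have [B [fB _]] := t0; apply: gauss_mean_convolution (tame_continuous t0) fB _ => //.
    rewrite !sqr_tau -mulrDr -natrD; congr (_ * _%:R); rewrite /i; lia.
  exact: tame_gauss_integrable (tame_gauss_mean _ t0).
rewrite gE in a2.
(* The bounds [b1] to [b4] move all derivative corrections back to the point 0, where they can
   cancel in the sum over [j]. *)
have b1 : `|m j * (g1 0 - f1 0)| <= `|m j| * (v * n%:R * M).
  apply: normM_le; apply: (linear_le M0 in_).
  have := gauss_mean_taylor1 (tau_neq0 i) T.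
  by rewrite sqr_tau /g1; under eq_fun do rewrite add0r.
have b2 : `|delta j / 2 * (g2 0 - f2 0)| <= `|delta j / 2| * (n%:R * (1 + v) * M).
  apply: normM_le; apply: (affine_le M0 in_).
  have := gauss_mean_taylor2 (tau_neq0 i) T.
  by rewrite sqr_tau /g2; under eq_fun do rewrite add0r.
have [b3 b4] := edge_le Nn jn T'.
have half k : `|delta k / 2| = `|delta k| / 2 by rewrite normrM [`|2^-1|]ger0_norm.
rewrite half in b2; rewrite half in b4.
have -> : (e + e' + n%:R * (c j + c i)) * M =
  e' * M + e * M + `|m j| * (v * n%:R * M) + `|delta j| / 2 * (n%:R * (1 + v) * M)
  + `|m i| * (v * n%:R * M) + `|delta i| / 2 * (n%:R * (1 + v) * M).
  by rewrite /c; ring.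
set l := L j (fun x => _) in a1 *; set l' := L j g in a1 a2.
rewrite (_ : l - _ - _ - _ = l - l' - m i * L j f1 - delta i / 2 * L j f2
    + (l' - gauss_mean (tau n) f - m j * g1 0 - delta j / 2 * g2 0)
    + m j * (g1 0 - f1 0) + delta j / 2 * (g2 0 - f2 0)
    + m i * (L j f1 - f1 0) + delta i / 2 * (L j f2 - f2 0)); last by field.
apply: (le_trans (ler_normD _ _)); apply: lerD; last exact: b4.
apply: (le_trans (ler_normD _ _)); apply: lerD; last exact: b3.
apply: (le_trans (ler_normD _ _)); apply: lerD; last exact: b2.
apply: (le_trans (ler_normD _ _)); apply: lerD; last exact: b1.
apply: (le_trans (ler_normD _ _)); apply: lerD; last exact: a2.
exact: a1.
Qed.

Let cs := \sum_(j < N) c j.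

Let cs_ge0 : 0 <= cs. Proof. by rewrite sumr_ge0. Qed.

Let sum_c n : (N <= n)%N -> \sum_(j < n) c j = cs.
Proof.
move=> Nn; rewrite -(subnKC Nn) big_split_ord /= [X in _ + X]big1 ?addr0// => j _.
by rewrite c_eq0//= leq_addr.
Qed.

Let close_step n (e : nat -> R) : (2 * N <= n)%N ->
  (forall j, (j < n)%N -> close j (e j)) ->
  close n (2 * (\sum_(j < n) e j) / n%:R + 2 * cs).
Proof.
move=> Nn ce M f f1 f2 T; have [T' _ _ _] := T; have M0 := taylor2_ge0 T'.
have Nn' : (N <= n)%N by lia.
have n0 : 0 < n%:R :> R by rewrite ltr0n; lia.
(* The corrections inserted on the right sum to 0 over [j], and those in [defect n] vanish, so this
   is only the recursion for [L n]. *)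
have -> : defect n f f1 f2 = n%:R^-1 * \sum_(j < n)
    (L j (fun x => L (n - 1 - j) (fun y => f (x + y))) - gauss_mean (tau n) f
    - (m j + m (n - 1 - j)) * f1 0 - (delta j + delta (n - 1 - j)) / 2 * f2 0).
  have S1 : \sum_(j < n) (m j + m (n - 1 - j)) = 0.
    by rewrite big_split /= (sum_rev_ord (fun j => m j)) (m0 Nn').2 addr0.
  have S2 : \sum_(j < n) (delta j + delta (n - 1 - j)) = 0.
    rewrite big_split /= (sum_rev_ord delta).
    by rewrite sumrB (sv Nn').2 -mulr_sumr sum_succ subrr addr0.
  rewrite 3!sumrB -Lrec// sumr_const card_ord -3!mulr_suml S1 S2.
  rewrite /defect /delta (m0 Nn').1 (sv Nn').1 subrr -mulr_natl.
  by field; rewrite gt_eqF.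
rewrite normrM ger0_norm ?invr_ge0 ?(ltW n0)// ler_pdivrMl//.
apply: le_trans (ler_norm_sum _ _ _) _.
apply: (@le_trans _ _ (\sum_(j < n)
  (e j + e (n - 1 - j)%N + n%:R * (c j + c (n - 1 - j)%N)) * M)).
  by apply: ler_sum => j _; apply: close_conv => //; apply: ce; have := ltn_ord j; lia.
have S (a : nat -> R) : \sum_(j < n) (a j + a (n - 1 - j)%N) = 2 * \sum_(j < n) a j.
  by rewrite big_split /= sum_rev_ord mulr2n mulrDl mul1r.
rewrite -mulr_suml big_split /= -mulr_sumr S S sum_c//.
by rewrite le_eqVlt; apply/orP; left; apply/eqP; field; rewrite gt_eqF.
Qed.

(* The induction closes because [e_j := K (j + 1) - 2 cs] solves
   [e_n = (2 / n) sum_(j < n) e_j + 2 cs] exactly. *)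
Theorem additive_recursion_gauss_mean : exists K : R, forall n M f f1 f2,
  (N <= n)%N -> tame_taylor2 M f f1 f2 ->
  `|L n f - gauss_mean (tau n) f| <= K * n.+1%:R * M.
Proof.
(* The sum dominates [e0] at each base index below [2 * N]; the summand [2 * cs] compensates the
   subtraction in the induction hypothesis. *)
pose K := \sum_(j < 2 * N) e0 j + 2 * cs.
have cK n : close n (K * n.+1%:R - 2 * cs).
  elim/ltn_ind: n => n IH; have [Nn|nN] := leqP (2 * N) n.
    move=> M f f1 f2 T; have := @close_step n _ Nn IH M f f1 f2 T.
    congr (_ <= _ * _); rewrite sumrB -mulr_sumr sum_succ sumr_const card_ord.
    rewrite -mulr_natr -natr1; field; rewrite pnatr_eq0; lia.
  move=> M f f1 f2 T; apply: le_trans (@close_e0 n _ _ _ _ T) _.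
  have [T' _ _ _] := T; rewrite ler_wpM2r ?(taylor2_ge0 T')// lerBrDr.
  apply: (@le_trans _ _ K).
    rewrite lerD2r (bigD1 (Ordinal nN))//= lerDl sumr_ge0// => j _; exact: e0_ge0.
  rewrite ler_peMr ?ler1n// addr_ge0 ?mulr_ge0// sumr_ge0// => j _; exact: e0_ge0.
exists K => n M f f1 f2 Nn T; have [T' _ _ _] := T; have M0 := taylor2_ge0 T'.
have := cK n _ _ _ _ T; rewrite /defect /delta (m0 Nn).1 (sv Nn).1 subrr !mul0r !subr0.
by move/le_trans; apply; rewrite ler_wpM2r// gerBl mulr_ge0.
Qed.

End additive_recursion.

(** * Convergence of distribution functions *)

Section smooth_step.
Context {R : realType}.
Implicit Types (x y h w M : R) (f : R -> R).

(** Expanding at [h = 1] and [h = -1] bounds the derivatives: the difference of the two expansions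
    isolates [f1], their sum isolates [f2]. *)
Lemma bounded_tame M f f1 f2 (B : R) : taylor2 M f f1 f2 ->
  (forall x, `|f x| <= B) -> tame_taylor2 M f f1 f2.
Proof.
move=> T fB; have M0 := taylor2_ge0 T; have [h0 h1 h2] := T.
have bnd x h : - B <= f (x + h) <= B by rewrite -ler_norml.
have f1B x : `|f1 x| <= B + M.
  have := bnd x 1; have := bnd x (-1); have := h0 x 1; have := h0 x (-1).
  rewrite normrN normr1 !expr1n sqrrN expr1n !ler_norml.
  by move=> /andP[? ?] /andP[? ?] /andP[? ?] /andP[? ?]; apply/andP; split; lra.
have f2B x : `|f2 x| <= 4 * B + 2 * M.
  have := bnd x 0; rewrite addr0.
  have := bnd x 1; have := bnd x (-1); have := h0 x 1; have := h0 x (-1).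
  rewrite normrN normr1 !expr1n sqrrN expr1n !ler_norml.
  move=> /andP[? ?] /andP[? ?] /andP[? ?] /andP[? ?] /andP[? ?].
  by apply/andP; split; lra.
have B0 : 0 <= B by exact: le_trans (normr_ge0 _) (fB 0).
(* Taylor bounds give the Lipschitz estimate only for [|h| <= 1]; at larger distances the supremum
   bound [2 * A] suffices. *)
have lip (g : R -> R) (A C : R) : 0 <= C -> (forall x, `|g x| <= A) ->
    (forall x h, `|h| <= 1 -> `|g (x + h) - g x| <= C * `|h|) -> tame g.
  move=> C0 gA gC; exists (2 * A + C).
  have A0 : 0 <= A by exact: le_trans (normr_ge0 _) (gA 0).
  split => [x|x y]; first by rewrite (le_trans (gA x))//; lra.
  have [xy|xy] := leP `|x - y| 1.
    have := gC y (x - y) xy; rewrite [y + _]addrC subrK => /le_trans; apply.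
    by rewrite ler_wpM2r// lerDr mulr_ge0.
  apply: (@le_trans _ _ (2 * A)).
    by rewrite (le_trans (ler_normB _ _))// mulr2n mulrDl mul1r lerD.
  rewrite (@le_trans _ _ (2 * A * `|x - y|)) ?ler_wpM2r ?lerDl//.
  by rewrite ler_peMr ?mulr_ge0// ltW.
have sq (h : R) : `|h| <= 1 -> h ^+ 2 <= `|h|.
  by move=> hh; rewrite -real_normK ?num_real// expr2 ler_piMr.
split=> //.
- apply: (lip _ B (B + M + (4 * B + 2 * M) + M)) => //; first lra.
  move=> x h hh.
  have : `|f (x + h) - f x| <= M * `|h| ^+ 3 + `|h| * (B + M) + h ^+ 2 / 2 * (4 * B + 2 * M).
    rewrite (_ : f (x + h) - f x = (f (x + h) - f x - h * f1 x - h ^+ 2 / 2 * f2 x)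
       + h * f1 x + h ^+ 2 / 2 * f2 x); last by ring.
    apply: le_trans (ler_normD _ _) _; apply: lerD.
      apply: le_trans (ler_normD _ _) _; apply: lerD => //.
      by rewrite normrM ler_wpM2l.
    by rewrite normrM ger0_norm ?divr_ge0 ?sqr_ge0// ler_wpM2l ?divr_ge0 ?sqr_ge0.
  move/le_trans; apply; have s2 := sq h hh.
  have s3 : `|h| ^+ 3 <= `|h| by rewrite exprS real_normK ?num_real// ler_piMr// (le_trans s2).
  have a1 : M * `|h| ^+ 3 <= M * `|h| by rewrite ler_wpM2l.
  have a2 : h ^+ 2 / 2 * (4 * B + 2 * M) <= `|h| * (4 * B + 2 * M).
    rewrite ler_wpM2r//; last by have := sqr_ge0 h; lra.
    lra.
  lra.
- apply: (lip _ (B + M) (4 * B + 2 * M + M)) => //; first lra.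
  move=> x h hh.
  have : `|f1 (x + h) - f1 x| <= M * h ^+ 2 + `|h| * (4 * B + 2 * M).
    rewrite (_ : f1 (x + h) - f1 x = (f1 (x + h) - f1 x - h * f2 x) + h * f2 x); last by ring.
    apply: le_trans (ler_normD _ _) _; apply: lerD => //.
    by rewrite normrM ler_wpM2l.
  move/le_trans; apply; have s2 := sq h hh.
  have a1 : M * h ^+ 2 <= M * `|h| by rewrite ler_wpM2l.
  lra.
- exact: (lip _ (4 * B + 2 * M) M).
Qed.

Lemma taylor2_affine M f f1 f2 (a b : R) : 0 <= a -> taylor2 M f f1 f2 ->
  taylor2 (M * a ^+ 3) (fun y => f (a * y + b)) (fun y => a * f1 (a * y + b))
    (fun y => a ^+ 2 * f2 (a * y + b)).
Proof.
move=> a0 [h0 h1 h2].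
have E x h : a * (x + h) + b = (a * x + b) + a * h by ring.
split => x h; rewrite E.
- have := h0 (a * x + b) (a * h); rewrite normrM (ger0_norm a0) exprMn mulrA.
  by congr (`|_| <= _); ring.
- rewrite (_ : _ - _ = a * (f1 (a * x + b + a * h) - f1 (a * x + b) - a * h * f2 (a * x + b))).
    have := h1 (a * x + b) (a * h); rewrite normrM (ger0_norm a0) => k.
    apply: le_trans (ler_wpM2l a0 k) _.
    by rewrite le_eqVlt; apply/orP; left; apply/eqP; ring.
  by ring.
- rewrite -mulrBr normrM ger0_norm ?sqr_ge0//.
  have := h2 (a * x + b) (a * h); rewrite normrM (ger0_norm a0) => k.
  apply: le_trans (ler_wpM2l (sqr_ge0 a) k) _.
  by rewrite le_eqVlt; apply/orP; left; apply/eqP; ring.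
Qed.

Lemma taylor2D M M' f f1 f2 (g g1 g2 : R -> R) : taylor2 M f f1 f2 ->
  taylor2 M' g g1 g2 ->
  taylor2 (M + M') (fun y => f y + g y) (fun y => f1 y + g1 y) (fun y => f2 y + g2 y).
Proof.
move=> [h0 h1 h2] [k0 k1 k2]; split => x h; rewrite [leRHS]mulrDl.
- have := le_trans (ler_normD _ _) (lerD (h0 x h) (k0 x h)).
  by congr (`|_| <= _); ring.
- have := le_trans (ler_normD _ _) (lerD (h1 x h) (k1 x h)).
  by congr (`|_| <= _); ring.
- have := le_trans (ler_normD _ _) (lerD (h2 x h) (k2 x h)).
  by congr (`|_| <= _); ring.
Qed.

Lemma taylor2Z M f f1 f2 (c : R) : taylor2 M f f1 f2 ->
  taylor2 (`|c| * M) (fun y => c * f y) (fun y => c * f1 y) (fun y => c * f2 y).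
Proof.
move=> [h0 h1 h2]; split => x h; rewrite -[leRHS]mulrA.
- rewrite (_ : _ - _ = c * (f (x + h) - f x - h * f1 x - h ^+ 2 / 2 * f2 x)); last by ring.
  by rewrite normrM ler_wpM2l.
- rewrite (_ : _ - _ = c * (f1 (x + h) - f1 x - h * f2 x)); last by ring.
  by rewrite normrM ler_wpM2l.
- by rewrite -mulrBr normrM ler_wpM2l.
Qed.

Definition pos_part y : R := if 0 <= y then y else 0.

(** The truncated cube has a Lipschitz second derivative, with constant 6. Each bound splits by the
    signs of [x] and [x + h]; when they differ, [|h|] dominates both [|x|] and [|x + h|]. *)
Lemma taylor2_pos_part : taylor2 6 (fun y => pos_part y ^+ 3)
  (fun y => 3 * pos_part y ^+ 2) (fun y => 6 * pos_part y).
Proof.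
have cube (u w : R) : 0 <= u <= w -> u ^+ 3 <= w ^+ 3.
  by move=> /andP[u0 uw]; rewrite lerXn2r// nnegrE (le_trans u0).
split => x h; rewrite /pos_part; case: (lerP 0 x) => x0; case: (lerP 0 (x + h)) => xh0.
- rewrite (_ : _ - _ = h ^+ 3); last by field.
  by rewrite normrX ler_peMl ?exprn_ge0// ler1n.
- have h0 : h < 0 by lra.
  have c1 := cube (- (x + h)) (- h) ltac:(apply/andP; split; lra).
  have c2 := exprn_ge0 3 (_ : 0 <= - (x + h)); have {}c2 := c2 ltac:(lra).
  rewrite (ltr0_norm h0) ler_norml expr0n /=; apply/andP; split; lra.
- have c1 := cube (x + h) h ltac:(apply/andP; split; lra).
  have c2 := exprn_ge0 3 xh0.
  have h0 : 0 < h by lra.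
  rewrite (gtr0_norm h0) ler_norml expr0n /=; apply/andP; split; lra.
- by rewrite !expr0n /= !mulr0 !subr0 normr0 mulr_ge0 ?exprn_ge0.
- by rewrite ler_norml; apply/andP; split; nra.
- rewrite expr0n /= mulr0 sub0r.
  have k1 : 0 <= x * (- h - (x + h)) by rewrite mulr_ge0; lra.
  have k2 := sqr_ge0 (h + x); have k3 := sqr_ge0 h.
  by rewrite ler_norml; apply/andP; split; nra.
- rewrite expr0n /= !mulr0 !subr0 ger0_norm; last by rewrite mulr_ge0 ?sqr_ge0.
  have : 0 <= - x * (h + (x + h)) by rewrite mulr_ge0; lra.
  nra.
- by rewrite expr0n /= !mulr0 !subr0 normr0 mulr_ge0 ?sqr_ge0.
- by rewrite -mulrBr normrM ger0_norm// addrC addKr.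
- have h0 : h < 0 by lra.
  by rewrite mulr0 sub0r normrN (ltr0_norm h0) ger0_norm; lra.
- have h0 : 0 < h by lra.
  by rewrite mulr0 subr0 (gtr0_norm h0) ger0_norm; lra.
- by rewrite subrr normr0 mulr_ge0.
Qed.

(* Integral of the quadratic B-spline with knots 0, 1, 2, 3. *)
Definition smooth_step y : R :=
  6^-1 * pos_part (1 * y + 0) ^+ 3 + (- (1/2)) * pos_part (1 * y + (-1)) ^+ 3
  + (1/2) * pos_part (1 * y + (-2)) ^+ 3 + (- 6^-1) * pos_part (1 * y + (-3)) ^+ 3.

Lemma smooth_step_taylor2 : exists M f1 f2, taylor2 M smooth_step f1 f2.
Proof.
do 3 eexists; apply: taylor2D; first apply: taylor2D; first apply: taylor2D.
all: apply: taylor2Z; apply: (taylor2_affine _ _ taylor2_pos_part) => //.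
Qed.

Lemma smooth_step_bounds y : [/\ 0 <= smooth_step y <= 1,
  y <= 0 -> smooth_step y = 0 & 3 <= y -> smooth_step y = 1].
Proof.
rewrite /smooth_step /pos_part !mul1r addr0.
case: (lerP 0 y) => y0; case: (lerP 0 (y + -1)) => y1;
  case: (lerP 0 (y + -2)) => y2; case: (lerP 0 (y + -3)) => y3; try lra.
- by split; [apply/andP; split; lra|lra|lra].
- have c := exprn_ge0 3 (_ : 0 <= - (y + -3)); have {}c := c ltac:(lra).
  have c1 : (- (y + -3)) ^+ 3 <= 1 by rewrite exprn_ile1; lra.
  rewrite expr0n /= mulr0 addr0; split; [apply/andP; split; lra|lra|lra].
- have c1 : 0 <= (y - 1) * (2 - y) by rewrite mulr_ge0; lra.
  have c2 : 0 <= (y - 1) * ((y - 1) * (2 - y)) by rewrite mulr_ge0; lra.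
  rewrite expr0n /= !mulr0 !addr0; split; [apply/andP; split; nra|lra|lra].
- have c1 : y ^+ 3 <= 1 by rewrite exprn_ile1; lra.
  have c := exprn_ge0 3 y0.
  rewrite expr0n /= !mulr0 !addr0; split; [apply/andP; split; lra| |lra].
  by move=> y4; rewrite (_ : y = 0) ?expr0n /=; lra.
- by rewrite expr0n /= !mulr0 !addr0; split; [apply/andP; split; lra|lra|lra].
Qed.

End smooth_step.

(** * From smooth test functions to distribution functions, and rescaling *)

Section normal_limit.
Context {R : realType}.
Implicit Types (x y : R) (f : R -> R).
Local Notation mu := (@lebesgue_measure R).

Lemma gauss_mean_indic s x :
  gauss_mean s (fun y => (y <= x)%R%:R) = fine (normal_prob 0 s `]-oo, x]%classic).
Proof.
rewrite /gauss_mean /normal_prob -[RHS]/(Rintegral mu `]-oo, x]%classic (normal_pdf 0 s)).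
rewrite [RHS]Rintegral_mkcond; apply: eq_Rintegral => y _.
by rewrite patchE mem_setE in_itv /=; case: ifP; rewrite ?mul1r ?mul0r.
Qed.

Lemma measurable_step x : measurable_fun setT (fun y : R => (y <= x)%R%:R : R).
Proof.
rewrite (_ : (fun _ => _) = \1_(`]-oo, x]%classic)); first exact: measurable_indic.
by apply/funext => y; rewrite indicE mem_setE in_itv.
Qed.

Lemma gauss_integrable_step s x : gauss_integrable s (fun y : R => (y <= x)%R%:R).
Proof.
apply: (@gauss_integrable_bounded _ _ _ 1); first exact: measurable_step.
by move=> y; case: (y <= x); rewrite ?normr1 ?normr0.
Qed.

(* Sandwich the indicator of a half-line between smooth steps of width [w]
   and let [w] tend to [0]. *)
Lemma cvg_cdf_gauss (p : nat -> (R -> R) -> R) s x :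
  (forall n, mean_functional (p n)) ->
  (forall M f f1 f2, tame_taylor2 M f f1 f2 ->
     (fun n => p n f) @ \oo --> gauss_mean s f) ->
  {for x, continuous (fun y : R => fine (normal_prob 0 s `]-oo, y]%classic))} ->
  (fun n => p n (fun y => (y <= x)%R%:R)) @ \oo -->
    fine (normal_prob 0 s `]-oo, x]%classic).
Proof.
move=> pm pcvg; pose F y := fine (normal_prob 0 s `]-oo, y]%classic).
rewrite -/F -/(F x) => cF; have FE y : gauss_mean s _ = F y := gauss_mean_indic s y.
have [M [f1 [f2 Tstep]]] := @smooth_step_taylor2 R.
(* A smooth descent from 1 at [z] to 0 at [z + w]; the factor 3 is the length of the interval on
   which [smooth_step] rises. *)
pose phi (w z : R) y := 1 - smooth_step (3 * w^-1 * y + (- (3 * w^-1 * z))) : R.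
have phi_cvg w z : 0 < w -> (fun n => p n (phi w z)) @ \oo --> gauss_mean s (phi w z).
  move=> w0; have a0 : 0 <= 3 * w^-1 by rewrite mulr_ge0// invr_ge0 ltW.
  have T1 := taylor2Z (-1) (taylor2_affine (- (3 * w^-1 * z)) a0 Tstep).
  have T0 : taylor2 0 (fun _ : R => 1) (fun=> 0) (fun=> 0).
    by split => *; rewrite ?mulr0 ?subrr ?subr0 ?normr0 !mul0r.
  have T := taylor2D T0 T1.
  have -> : phi w z = fun y => 1 + -1 * smooth_step (3 * w^-1 * y + (- (3 * w^-1 * z))).
    by apply/funext => y; rewrite mulN1r.
  apply: (pcvg _ _ _ _ (@bounded_tame _ _ _ _ _ 1 T _)) => y.
  have [/andP[? ?] _ _] := @smooth_step_bounds R (3 * w^-1 * y + (- (3 * w^-1 * z))).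
  by rewrite mulN1r ger0_norm; lra.
have phi_lower w z y : 0 < w -> (y <= z)%R%:R <= phi w z y.
  move=> w0; rewrite /phi -mulrBr.
  have [/andP[b0 b1] e0 _] := @smooth_step_bounds R (3 * w^-1 * (y - z)).
  have [yz|yz] := leP y z; last by rewrite subr_ge0.
  by rewrite e0 ?subr0// mulr_ge0_le0 ?subr_le0// mulr_ge0// invr_ge0 ltW.
have phi_upper w z y : 0 < w -> phi w z y <= (y <= z + w)%R%:R.
  move=> w0; rewrite /phi -mulrBr.
  have [/andP[b0 b1] _ e1] := @smooth_step_bounds R (3 * w^-1 * (y - z)).
  have [yz|yz] := leP y (z + w); first by rewrite gerBl.
  rewrite e1 ?subrr// -mulrA ler_peMr// mulrC ler_pdivlMr// mul1r; lra.
have iphi w z : 0 < w -> gauss_integrable s (phi w z).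
  move=> w0; apply: (@gauss_integrable_bounded _ _ _ 1).
    rewrite /phi; apply: measurable_funB => //.
    apply: measurableT_comp.
      apply: continuous_measurable_fun; apply: tame_continuous.
      have [] := @bounded_tame _ _ _ _ _ 1 Tstep _ => // y.
      by have [/andP[? ?] _ _] := @smooth_step_bounds R y; rewrite ger0_norm.
    by apply: measurable_funD => //; apply: measurable_funM.
  move=> y; have [/andP[? ?] _ _] := @smooth_step_bounds R (3 * w^-1 * y + (- (3 * w^-1 * z))).
  by rewrite /phi ger0_norm; lra.
apply/(@cvgrPdist_le _ R^o) => e e0; have e20 : 0 < e / 2 by rewrite divr_gt0.
have [w /= w0 Fw] : exists2 w, 0 < w & forall y, `|x - y| <= w -> `|F x - F y| <= e / 2.
  move/(@cvgrPdist_le _ R^o) : cF => /(_ _ e20) /nbhs_ballP[w /= w0 hw].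
  exists (w / 2); first by rewrite divr_gt0.
  move=> y xy; apply: hw; rewrite /ball /= (le_lt_trans xy)//; lra.
have Fp : F (x + w) <= F x + e / 2.
  have := Fw (x + w); rewrite opprD addNKr normrN gtr0_norm// => /(_ (lexx _)).
  rewrite ler_norml => /andP[? ?]; lra.
have Fm : F x - e / 2 <= F (x - w).
  have := Fw (x - w); rewrite opprB addrC subrK gtr0_norm// => /(_ (lexx _)).
  rewrite ler_norml => /andP[? ?]; lra.
(* The descent starting at [x] lies above the indicator, the one starting at [x - w] and ending at
   [x] lies below it. *)
have up := phi_cvg w x w0; have lo := phi_cvg w (x - w) w0.
have up_le : gauss_mean s (phi w x) <= F (x + w).
  rewrite -FE; apply: le_gauss_mean; [exact: iphi|exact: gauss_integrable_step|].
  by move=> y; exact: phi_upper.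
have lo_ge : F (x - w) <= gauss_mean s (phi w (x - w)).
  rewrite -FE; apply: le_gauss_mean; [exact: gauss_integrable_step|exact: iphi|].
  by move=> y; exact: phi_lower.
near=> n.
have h1 : `|gauss_mean s (phi w x) - p n (phi w x)| <= e / 2.
  by near: n; apply: (@cvgr_dist_le _ R^o _ _ _ _ _ up).
have h2 : `|gauss_mean s (phi w (x - w)) - p n (phi w (x - w))| <= e / 2.
  by near: n; apply: (@cvgr_dist_le _ R^o _ _ _ _ _ lo).
have k1 : p n (fun y => (y <= x)%R%:R) <= p n (phi w x).
  by apply: (le_mean (pm n)) => y; exact: phi_lower.
have k2 : p n (phi w (x - w)) <= p n (fun y => (y <= x)%R%:R).
  apply: (le_mean (pm n)) => y; have := phi_upper w (x - w) y w0.
  by rewrite subrK.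
move: h1 h2; rewrite !ler_norml => /andP[h1 _] /andP[_ h2].
apply/andP; split; first by clear -h1 k1 up_le Fp; lra.
by clear -h2 k2 lo_ge Fm; lra.
Unshelve. all: by end_near. Qed.

Lemma cvg_dist_sqrtn (u : nat -> R) (l C : R) (N : nat) :
  (forall n, (N <= n)%N -> (0 < n)%N -> `|l - u n| <= C / Num.sqrt n%:R) ->
  u @ \oo --> l.
Proof.
move=> key; apply/(@cvgrPdist_le _ R^o) => e e0; near=> n.
have n0 : (0 < n)%N by near: n; exact: nbhs_infty_gt.
have Nn : (N <= n)%N by near: n; exact: nbhs_infty_ge.
apply: le_trans (key n Nn n0) _.
apply: (@le_trans _ _ (`|C| / Num.sqrt n%:R)).
  by rewrite ler_wpM2r ?invr_ge0 ?sqrtr_ge0// ler_norm.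
rewrite ler_pdivrMr ?sqrtr_gt0 ?ltr0n// mulrC -ler_pdivrMr//.
rewrite -(@ler_pXn2r _ 2) ?nnegrE ?divr_ge0 ?sqrtr_ge0 ?(ltW e0)// sqr_sqrtr//.
near: n; exact: nbhs_infty_ger.
Unshelve. all: by end_near. Qed.

Lemma cvg_dist_natn (u : nat -> R) (l C : R) (N : nat) :
  (forall n, (N <= n)%N -> (0 < n)%N -> `|l - u n| <= C / n%:R) ->
  u @ \oo --> l.
Proof.
move=> key; apply: (@cvg_dist_sqrtn _ _ `|C| N) => n Nn n0.
apply: le_trans (key n Nn n0) _.
have s1 : 1 <= Num.sqrt n%:R :> R by rewrite -[leLHS]sqrtr1 ler_sqrt ?ler1n ?ltr0n.
have s0 := lt_le_trans ltr01 s1.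
rewrite ler_pdivrMr ?ltr0n// -{2}[n%:R]sqr_sqrtr// -mulrA expr2 mulKf ?gt_eqF//.
by rewrite (le_trans (ler_norm _))// ler_peMr.
Qed.

Lemma gauss_mean_quadratic s (a c : R) : s != 0 ->
  gauss_integrable s (fun y => a + c * y ^+ 2) /\
  gauss_mean s (fun y => a + c * y ^+ 2) = a + c * s ^+ 2.
Proof.
move=> s0; have i := gauss_integrable_sqr s0.
have iZ := gauss_integrableZ c i; have ia := gauss_integrable_cst s a.
split; first exact: gauss_integrableD.
by rewrite (gauss_meanD ia iZ) gauss_mean_cst (gauss_meanZ _ i) (gauss_mean_moments s0).2.
Qed.

(** Meant for [r = sqrt n] and [q = sqrt (n + 1)]: both the shift [b] and the discrepancy between
    [n] and [n + 1] cost O(1 / r), with at most quadratic growth in [y]. *)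
Lemma rescaling_error (B r q b y : R) : 0 <= B -> 0 < r -> r <= q -> q <= r + 1 ->
  B * `|y - (r^-1 * (q * y) + b / r)| <= B / r * (1 + `|b|) + B / r * y ^+ 2.
Proof.
move=> B0 r0 rq qr.
have -> : B / r * (1 + `|b|) + B / r * y ^+ 2 = B * (r^-1 * (1 + `|b| + y ^+ 2)) by ring.
rewrite ler_wpM2l//.
have -> : y - (r^-1 * (q * y) + b / r) = - (r^-1 * ((q - r) * y + b)).
  by field; rewrite gt_eqF.
rewrite normrN normrM ger0_norm ?invr_ge0 ?(ltW r0)// ler_wpM2l ?invr_ge0 ?(ltW r0)//.
apply: le_trans (ler_normD _ _) _; rewrite addrAC lerD2r normrM.
apply: le_trans _ (norm_le1Dsqr y).
by rewrite ler_piMl// ger0_norm ?subr_ge0// lerBlDl.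
Qed.

(* Rescaling by [a = n^(-1/2)] turns the third-derivative bound [M] into
   [M a^3], which beats the linear growth of the error. *)
Lemma cvg_rescaled_gauss_mean (L : nat -> (R -> R) -> R) (v b K : R) (N : nat) M f f1 f2 :
  0 < v ->
  (forall n M f f1 f2, (N <= n)%N -> tame_taylor2 M f f1 f2 ->
     `|L n f - gauss_mean (Num.sqrt (v * n.+1%:R)) f| <= K * n.+1%:R * M) ->
  tame_taylor2 M f f1 f2 ->
  (fun n => L n (fun y => f ((y + b) / Num.sqrt n%:R))) @ \oo -->
    gauss_mean (Num.sqrt v) f.
Proof.
move=> v0 LK T; have [T' tf _ _] := T; have [B [fB fL]] := tf.
have M0 := taylor2_ge0 T'.
have B0 : 0 <= B by exact: le_trans (normr_ge0 _) (fB 0).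
have sv0 : Num.sqrt v != 0 by rewrite gt_eqF// sqrtr_gt0.
(* The first term is the approximation error, with [n + 1 <= 2 * n]; the second is [rescaling_error]
   averaged against variance [v]. *)
pose C := 2 * `|K| * M + B * (1 + v + `|b|).
have key n : (N <= n)%N -> (0 < n)%N ->
  `|gauss_mean (Num.sqrt v) f - L n (fun y => f ((y + b) / Num.sqrt n%:R))|
     <= C / Num.sqrt n%:R.
  move=> Nn n0; set r := Num.sqrt n%:R.
  have r0 : 0 < r by rewrite sqrtr_gt0 ltr0n.
  have r2 : r ^+ 2 = n%:R by rewrite sqr_sqrtr.
  have ri0 : 0 <= r^-1 by rewrite invr_ge0 ltW.
  pose q := Num.sqrt (n.+1%:R : R).
  have q0 : 0 < q by rewrite sqrtr_gt0 ltr0n.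
  have q2 : q ^+ 2 = r ^+ 2 + 1 by rewrite sqr_sqrtr// r2 natr1.
  have rq : r <= q by rewrite ler_sqrt// ler_nat.
  have qr : q <= r + 1 by rewrite -(@ler_pXn2r _ 2) ?nnegrE ?addr_ge0 ?(ltW q0) ?(ltW r0)// q2; nra.
  pose g y := f (r^-1 * y + b / r).
  have gE : (fun y => f ((y + b) / r)) = g.
    by apply/funext => y; rewrite /g mulrDl [y / r]mulrC.
  have Tg := bounded_tame (taylor2_affine (b / r) ri0 T') (fun y => fB _).
  have cg : continuous g by have [_ /tame_continuous] := Tg.
  have step1 : `|L n g - gauss_mean (Num.sqrt (v * n.+1%:R)) g| <= 2 * `|K| * M / r.
    apply: le_trans (LK n _ _ _ _ Nn Tg) _.
    apply: (@le_trans _ _ (`|K| * (2 * r ^+ 2) * (M * r^-1 ^+ 3))).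
      rewrite ler_wpM2r ?mulr_ge0 ?exprn_ge0//.
      apply: (@le_trans _ _ (`|K| * n.+1%:R)); first by rewrite ler_wpM2r ?ler_norm.
      by apply: (ler_wpM2l (normr_ge0 K)); rewrite r2 -natrM ler_nat mul2n -addnn -[leqLHS]addn1 leq_add2l.
    by rewrite le_eqVlt; apply/orP; left; apply/eqP; field; rewrite gt_eqF.
  have scal : gauss_mean (Num.sqrt (v * n.+1%:R)) g = gauss_mean (Num.sqrt v) (fun y => g (q * y)).
    rewrite mulrC sqrtrM; last exact: ler0n.
    exact: (gauss_mean_scale q0 sv0 cg (fun y => fB _)).
  have step2 : `|gauss_mean (Num.sqrt v) f - gauss_mean (Num.sqrt v) (fun y => g (q * y))|
      <= B * (1 + v + `|b|) / r.
    have i1 := tame_gauss_integrable (Num.sqrt v) tf.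
    have i2 : gauss_integrable (Num.sqrt v) (fun y => g (q * y)).
      apply: (@cts_gauss_integrable _ _ _ B); last by move=> y; exact: fB.
      by move=> y; apply: continuous_comp; [exact: mulrl_continuous|exact: cg].
    pose h (y : R) := B / r * (1 + `|b|) + B / r * y ^+ 2.
    have [ih hE] := gauss_mean_quadratic (B / r * (1 + `|b|)) (B / r) sv0.
    have -> : B * (1 + v + `|b|) / r = gauss_mean (Num.sqrt v) h.
      by rewrite hE (sqr_sqrtr (ltW v0)); ring.
    rewrite -(gauss_meanB i1 i2).
    apply: (gauss_mean_le_norm (gauss_integrableB i1 i2) ih).
    move=> y; apply: le_trans (fL _ _) _.
    exact: rescaling_error.
  rewrite gE (_ : C / r = 2 * `|K| * M / r + B * (1 + v + `|b|) / r); last by rewrite /C mulrDl.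
  rewrite scal in step1.
  rewrite distrC (_ : _ - _ = (L n g - gauss_mean (Num.sqrt v) (fun y => g (q * y)))
    - (gauss_mean (Num.sqrt v) f - gauss_mean (Num.sqrt v) (fun y => g (q * y)))); last by ring.
  by apply: le_trans (ler_normB _ _) _; exact: lerD.
exact: (cvg_dist_sqrtn key).
Qed.

End normal_limit.

(** * Binary search trees *)

Section tree_combinatorics.

Lemma nb_nodes_Node l r : nb_nodes (Node l r) = (nb_nodes l + nb_nodes r).+1.
Proof. by rewrite /nb_nodes /= size_cat !size_map. Qed.

Lemma nb_fringe_Node t l r :
  nb_fringe t (Node l r) = (nb_fringe t l + nb_fringe t r + (Node l r == t))%N.
Proof.
rewrite /nb_fringe /= count_cat !count_map addnC.
by congr (_ + _ + _)%N; apply: eq_count.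
Qed.

Lemma nb_nodes_eq0 T : (nb_nodes T == 0%N) = (T == EmptyTree).
Proof. by case: T => [|l r]. Qed.

Lemma extensionK : cancel extension internal.
Proof.
elim=> [|l IHl r IHr] //=; rewrite IHl IHr.
by case: l {IHl} => [|? ?]; case: r {IHr} => [|? ?].
Qed.

Lemma extension_neq0 T : extension T != EmptyTree.
Proof. by case: T. Qed.

Lemma nb_nodes_extension T : nb_nodes (extension T) = (2 * nb_nodes T).+1.
Proof. by elim: T => [|l IHl r IHr] //=; rewrite !nb_nodes_Node IHl IHr; lia. Qed.

Lemma outdeg_Node_root l r :
  outdeg (Node l r) [::] = ((l != EmptyTree) + (r != EmptyTree))%N.
Proof. by []. Qed.

Lemma count_nodes_Node (a : pred nat) l r :
  count (fun v => a (outdeg (Node l r) v)) (nodes (Node l r)) =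
  (a ((l != EmptyTree) + (r != EmptyTree)) +
   count (fun v => a (outdeg l v)) (nodes l) +
   count (fun v => a (outdeg r v)) (nodes r))%N.
Proof.
by rewrite /= count_cat !count_map addnA; congr (_ + _ + _)%N; apply: eq_count.
Qed.

Lemma nb_internal_extension T : nb_internal (extension T) = nb_nodes T.
Proof.
elim: T => [|l IHl r IHr] //=; rewrite /nb_internal (count_nodes_Node (fun d => d != 0%N)).
rewrite -!/(nb_internal _) IHl IHr !extension_neq0 nb_nodes_Node; lia.
Qed.

Lemma nb_leaves_extension T : nb_leaves (extension T) = (nb_nodes T).+1.
Proof.
elim: T => [|l IHl r IHr] //=; rewrite /nb_leaves (count_nodes_Node (fun d => d == 0%N)).
rewrite -!/(nb_leaves _) IHl IHr !extension_neq0 nb_nodes_Node /=; lia.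
Qed.

Lemma full_Node l r : full (Node l r) =
  (((l == EmptyTree) && (r == EmptyTree)) || (full l && full r)).
Proof.
rewrite /full /= all_cat !all_map outdeg_Node_root.
rewrite (@eq_all _ _ (fun v => outdeg l v \in [:: 0; 2]%N))//.
rewrite [X in _ && (_ && X)](@eq_all _ _ (fun v => outdeg r v \in [:: 0; 2]%N))//.
case: (eqVneq l EmptyTree) => [->|l0]; case: (eqVneq r EmptyTree) => [->|r0].
all: rewrite ?inE /= ?andbF ?andbT //.
Qed.

Lemma full_extension T : full (extension T).
Proof.
by elim: T => [|l IHl r IHr] //=; rewrite full_Node IHl IHr orbT.
Qed.

(** With [extensionK] and [full_extension], [extension] is a bijection from all trees onto the full
    ones, with [EmptyTree] matching [bullet]; this transports every claim about a full tree to its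
    internal tree. *)
Lemma fullP t : full t -> exists T, t = extension T.
Proof.
elim: t => [|l IHl r IHr]//; rewrite full_Node => /orP[/andP[/eqP-> /eqP->]|/andP[]].
  by exists EmptyTree.
by move=> /IHl[l' ->] /IHr[r' ->]; exists (Node l' r').
Qed.

Lemma extension_eq_bullet T : (extension T == bullet) = (T == EmptyTree).
Proof. exact: (inj_eq (can_inj extensionK) T EmptyTree). Qed.

Lemma nb_fringe_bullet_extension T : nb_fringe bullet (extension T) = (nb_nodes T).+1.
Proof.
elim: T => [|l IHl r IHr] //=; rewrite nb_fringe_Node IHl IHr nb_nodes_Node.
by rewrite (extension_eq_bullet (Node l r)) addn0 addSn addnS.
Qed.

Lemma nb_fringe_extension_Node T l r :
  nb_fringe (extension T) (extension (Node l r)) =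
  (nb_fringe (extension T) (extension l) + nb_fringe (extension T) (extension r)
   + (Node l r == T))%N.
Proof.
by rewrite /= nb_fringe_Node (inj_eq (can_inj extensionK) (Node l r)).
Qed.

Lemma nb_fringe_extension0 T : T != EmptyTree ->
  nb_fringe (extension T) (extension EmptyTree) = 0%N.
Proof.
by move=> T0; rewrite /nb_fringe /= eq_sym extension_eq_bullet (negbTE T0).
Qed.

Lemma nb_fringe_small T S : T != EmptyTree -> (nb_nodes S < nb_nodes T)%N ->
  nb_fringe (extension T) (extension S) = 0%N.
Proof.
move=> T0; elim: S => [|l IHl r IHr] h; first exact: nb_fringe_extension0.
rewrite nb_fringe_extension_Node; rewrite nb_nodes_Node in h.
rewrite IHl ?IHr//; [|lia|lia]; case: eqP => // E; move: h; rewrite -E nb_nodes_Node; lia.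
Qed.

Lemma nb_fringe_same_size T S : T != EmptyTree -> nb_nodes S = nb_nodes T ->
  nb_fringe (extension T) (extension S) = (S == T).
Proof.
case: S => [|l r] T0.
  by move=> /esym/eqP; rewrite nb_nodes_eq0 (negbTE T0).
move=> h; rewrite nb_fringe_extension_Node; rewrite nb_nodes_Node in h.
by rewrite !nb_fringe_small//; lia.
Qed.

End tree_combinatorics.

(** * The law of the search tree as a finite sum *)

Section bst_mean.
Context {R : realType}.
Implicit Types (s : seq R) (F G : btree -> R).

(** Hook-length formula: the product over all nodes [v] of the inverse size of the fringe tree at
    [v]. *)
Fixpoint bst_weight (t : btree) : R :=
  if t is Node l r then bst_weight l * bst_weight r / (nb_nodes t)%:R else 1.

Lemma bst_weight_gt0 t : 0 < bst_weight t.
Proof.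
elim: t => [|l IHl r IHr] //=.
by rewrite divr_gt0 ?mulr_gt0// ltr0n nb_nodes_Node.
Qed.

(** In sorted order the key at position [i] has exactly [i] smaller keys, so each rank below the
    size occurs once. *)
Lemma sum_rank s (n : nat) : uniq s ->
  \sum_(x <- s) ((count (fun y => y < x) s == n)%:R : R) = (n < size s)%:R.
Proof.
move=> us; set s' := sort <=%O s.
have ps : perm_eq s' s by rewrite perm_sort.
have ss : sorted <%O s' by rewrite lt_sorted_uniq_le sort_uniq us sort_le_sorted.
rewrite -(perm_big _ ps) /= -(perm_size ps) (big_nth 0).
under eq_big_nat => i /andP[_ i_s].
  rewrite -(permP ps) (_ : count _ s' = i); last exact: count_lt_nth.
  over.
have [ns|ns] := ltnP n (size s').
  rewrite (bigD1_seq n) ?mem_index_iota ?iota_uniq//= eqxx big1 ?addr0// => i.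
  by move/negbTE->.
rewrite big_nat big1// => i /andP[_ i_s]; rewrite ltn_eqF//.
exact: leq_trans i_s ns.
Qed.

Lemma count_split s x : uniq s -> x \in s ->
  (count (fun y => (y < x)%R) s + count (fun y => (x < y)%R) s).+1 = size s.
Proof.
move=> us xs; rewrite -[RHS](count_predC (fun y => y < x)).
rewrite -addnS; congr (_ + _)%N.
rewrite [RHS](eq_count (a2 := predU (pred1 x) (fun y => x < y))); last first.
  by move=> y /=; rewrite -leNgt le_eqVlt eq_sym.
have := count_predUI (pred1 x) (fun y => x < y) s.
rewrite (count_uniq_mem _ us) xs (@eq_count _ (predI _ _) pred0) ?count_pred0.
  by rewrite addn0 => ->.
by move=> y /=; case: eqP => // ->; rewrite ltxx.
Qed.

(** Only the pivot of rank [nb_nodes l] leaves subtrees of the right sizes. Hence the factor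
    [1 / size s] at each node, and the law depends on the keys only through their number. *)
Lemma bst_pmfE s t : uniq s ->
  bst_pmf s t = (nb_nodes t == size s)%:R * bst_weight t.
Proof.
elim: t s => [|l IHl r IHr] s us.
  by rewrite /= mulr1 -size_eq0 eq_sym.
rewrite [LHS]/= big_seq.
under eq_bigr => x xs.
  rewrite IHl ?filter_uniq// IHr ?filter_uniq// !size_filter.
  have -> : (nb_nodes l == count (fun y => y < x) s)%:R * bst_weight l *
    ((nb_nodes r == count (fun y => x < y) s)%:R * bst_weight r) =
    (count (fun y => y < x) s == nb_nodes l)%:R *
      ((nb_nodes (Node l r) == size s)%:R * (bst_weight l * bst_weight r)) :> R.
    rewrite -(count_split us xs) nb_nodes_Node eqSS mulrACA [RHS]mulrA; congr (_ * _).
    rewrite -!natrM !mulnb [X in X && _]eq_sym; congr (nat_of_bool _)%:R.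
    by case: eqP => //= ->; rewrite eqn_add2l.
  over.
rewrite -big_seq -mulr_suml sum_rank//= nb_nodes_Node.
have [<-|] := eqVneq (nb_nodes l + nb_nodes r).+1 (size s); last by rewrite !mul0r !mulr0.
by rewrite ltnS leq_addr !mul1r mulrC.
Qed.

Definition btrees (n : nat) : seq btree := [seq t <- trees n | nb_nodes t == n].

Lemma mem_trees h t : (nb_nodes t <= h)%N -> t \in trees h.
Proof.
elim: h t => [|h IH] [|l r]//; rewrite nb_nodes_Node ltnS => lr.
rewrite inE /=; apply/allpairsP; exists (l, r); split=> //=; apply: IH; lia.
Qed.

Lemma mem_btrees n t : (t \in btrees n) = (nb_nodes t == n).
Proof.
rewrite mem_filter; case: eqP => //= <-; exact: mem_trees.
Qed.

Lemma sum_trees h n F : (n <= h)%N ->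
  \sum_(t <- trees h | nb_nodes t == n) F t = \sum_(t <- btrees n) F t.
Proof.
move=> nh; rewrite -big_filter; apply: perm_big; apply: uniq_perm.
- by rewrite filter_uniq// trees_uniq.
- by rewrite filter_uniq// trees_uniq.
move=> t; rewrite mem_btrees mem_filter; case: eqP => //= tn.
by apply: mem_trees; rewrite tn.
Qed.

Definition bst_mean (n : nat) F : R := \sum_(t <- btrees n) bst_weight t * F t.

Lemma eq_bst_mean n F G : (forall t, nb_nodes t = n -> F t = G t) ->
  bst_mean n F = bst_mean n G.
Proof.
move=> FG; rewrite /bst_mean big_seq [RHS]big_seq; apply: eq_bigr => t.
by rewrite mem_btrees => /eqP /FG ->.
Qed.

Lemma bst_mean0 F : bst_mean 0 F = F EmptyTree.
Proof. by rewrite /bst_mean /btrees /= big_seq1 mul1r. Qed.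

(** The size of the left subtree is uniform on 0, ..., [n], and given it the two subtrees are
    independent. *)
Lemma bst_meanS n F : n.+1%:R * bst_mean n.+1 F =
  \sum_(j < n.+1) bst_mean j (fun l => bst_mean (n - j) (fun r => F (Node l r))).
Proof.
rewrite /bst_mean -(sum_trees _ (leqnn _)) /= big_cons /= big_mkcond /=.
rewrite big_allpairs_dep /= mulr_sumr.
transitivity (\sum_(l <- trees n) \sum_(r <- trees n) \sum_(j < n.+1)
   (if nb_nodes l == j then if nb_nodes r == (n - j)%N then
      bst_weight l * (bst_weight r * F (Node l r)) else 0 else 0)).
  apply: eq_bigr => l _; rewrite mulr_sumr; apply: eq_bigr => r _.
  rewrite nb_nodes_Node eqSS.
  have [E|NE] := eqVneq.
    have ln : (nb_nodes l < n.+1)%N by lia.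
    rewrite (bigD1 (Ordinal ln))//= eqxx big1 ?addr0 => [|j jl]; last first.
      by rewrite ifN// eq_sym.
    rewrite (_ : nb_nodes r == _ = true); last by lia.
    by rewrite E; field; rewrite ?natr1 ?nat1r pnatr_eq0.
  rewrite mulr0 big1// => j _; case: eqP => // E1; case: eqP => // E2.
  by have := ltn_ord j; lia.
rewrite (eq_bigr (fun l => \sum_(j < n.+1) \sum_(r <- trees n)
   (if nb_nodes l == j then if nb_nodes r == (n - j)%N then
      bst_weight l * (bst_weight r * F (Node l r)) else 0 else 0))); last first.
  by move=> l _; exact: exchange_big.
rewrite exchange_big /=; apply: eq_bigr => j _.
have jn : (j <= n)%N by rewrite -ltnS.
rewrite -(sum_trees _ jn) [RHS]big_mkcond /=; apply: eq_bigr => l _.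
case: eqP => // _; last by rewrite big1.
by rewrite -(sum_trees _ (leq_subr j n)) mulr_sumr [RHS]big_mkcond.
Qed.

Lemma bst_meanD n F G : bst_mean n (fun t => F t + G t) = bst_mean n F + bst_mean n G.
Proof. by rewrite /bst_mean -big_split; apply: eq_bigr => t _; rewrite mulrDr. Qed.

Lemma bst_meanZ n (c : R) F : bst_mean n (fun t => c * F t) = c * bst_mean n F.
Proof. by rewrite /bst_mean mulr_sumr; apply: eq_bigr => t _; rewrite mulrCA. Qed.

Lemma bst_mean_ge0 n F : (forall t, 0 <= F t) -> 0 <= bst_mean n F.
Proof.
by move=> F0; rewrite sumr_ge0// => t _; rewrite mulr_ge0// ltW// bst_weight_gt0.
Qed.

Lemma bst_mean_cst n (c : R) : bst_mean n (fun=> c) = c.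
Proof.
elim/ltn_ind: n => -[|n] IH; first exact: bst_mean0.
apply: (@mulfI _ n.+1%:R); first by rewrite pnatr_eq0.
rewrite bst_meanS (eq_bigr (fun=> c)) ?sumr_const ?card_ord ?mulr_natl// => j _.
have nj : (n - j < n.+1)%N by rewrite ltnS leq_subr.
by rewrite (IH _ nj) IH.
Qed.

Lemma bst_mean_functional n (u : btree -> R) :
  mean_functional (fun f : R -> R => bst_mean n (fun t => f (u t))).
Proof.
split => [f g|c f|c|f f0].
- exact: bst_meanD.
- exact: bst_meanZ.
- exact: bst_mean_cst.
- exact: bst_mean_ge0.
Qed.

Lemma bst_mean_indic n t : nb_nodes t = n ->
  bst_mean n (fun u => (u == t)%:R) = bst_weight t.
Proof.
move=> tn; rewrite /bst_mean (bigD1_seq t)/=; first last.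
- by rewrite filter_uniq// trees_uniq.
- by rewrite mem_btrees tn.
by rewrite eqxx mulr1 big1 ?addr0// => u /negbTE ->; rewrite mulr0.
Qed.

End bst_mean.

Section bst_expectation.
Context {R : realType}.
Implicit Types (s : seq R) (F : btree -> R).

Lemma bst_prob_set1 s t : bst_prob s [set t] = (bst_pmf s t)%:E.
Proof. by rewrite /bst_prob esum_set1// lee_fin bst_pmf_ge0. Qed.

Lemma bst_prob_nb_nodes s : uniq s ->
  bst_prob s [set t | nb_nodes t != size s] = 0%E.
Proof.
move=> us; rewrite /bst_prob esum1// => t /= /negbTE tn.
by rewrite bst_pmfE// tn mul0r.
Qed.

Lemma bst_expectation s F : uniq s ->
  ('E_(bst_prob s)[F] = (bst_mean (size s) F)%:E)%E.
Proof.
move=> us; rewrite unlock.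
(* A finite combination of point indicators that agrees with [F] almost surely, as the law charges
   only trees with [size s] nodes. *)
pose G t := \sum_(u <- btrees (size s)) F u * \1_[set u] t.
rewrite (ae_eq_integral (EFin \o G))//; last first.
  exists [set t | nb_nodes t != size s]; split=> //; first exact: bst_prob_nb_nodes.
  move=> t /=; apply: contra_notN => /eqP tn _; congr EFin; rewrite /G.
  rewrite (bigD1_seq t)/=; first last.
  - by rewrite filter_uniq// trees_uniq.
  - by rewrite mem_btrees tn.
  rewrite indicE mem_set// mulr1 big1 ?addr0// => u ut.
  by rewrite indicE memNset ?mulr0// => /= tu; rewrite tu eqxx in ut.
rewrite /G; under eq_integral do rewrite /= -sumEFin.
rewrite integral_sum//; last first.
  move=> u; rewrite (_ : (fun _ => _) = fun t => (F u)%:E * (\1_[set u] t)%:E)%E//.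
  by apply: integrableZl => //; exact: integrable_indic.
rewrite /bst_mean -sumEFin big_seq [RHS]big_seq; apply: eq_bigr => u.
rewrite mem_btrees => /eqP un.
under eq_integral do rewrite EFinM.
rewrite integralZl//; last exact: integrable_indic.
rewrite integral_indic// setIT mulrC EFinM; congr (_ * _)%E.
by rewrite -[LHS]/(bst_prob s [set u]) bst_prob_set1 bst_pmfE// un eqxx mul1r.
Qed.

Lemma bst_prob_mean s (A : set btree) : uniq s ->
  bst_prob s A = (bst_mean (size s) (\1_A))%:E.
Proof.
by move=> us; rewrite -bst_expectation// expectation_indic.
Qed.

End bst_expectation.

(** * Fringe trees *)

Section series.
Context {R : realType}.

Lemma eseries_single (f : nat -> \bar R) (N k : nat) : (N <= k)%N ->
  (forall i, i != k -> f i = 0%E) -> (\sum_(N <= i <oo) f i = f k)%E.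
Proof.
move=> Nk f0; apply/cvg_lim => //; apply: cvg_near_cst; near=> n.
have kn : (k < n)%N by near: n; exact: nbhs_infty_gt.
rewrite (bigD1_seq k) ?iota_uniq ?mem_index_iota ?Nk//= big1 ?adde0.
Unshelve. all: by end_near. Qed.

Definition fringe_size_prob (k : nat) : R := 1 / ((k%:R + 1) * (k%:R + 2)).

Lemma fringe_size_prob_gt0 k : 0 < fringe_size_prob k.
Proof. by rewrite divr_gt0// mulr_gt0 ?ltr_wpDl. Qed.

(** Telescoping, as [1 / ((k + 1) (k + 2)) = 1 / (k + 1) - 1 / (k + 2)]. *)
Lemma sum_fringe_size_prob n :
  \sum_(0 <= k < n) fringe_size_prob k = 1 - n.+1%:R^-1.
Proof.
elim: n => [|n IH]; first by rewrite big_geq// invr1 subrr.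
rewrite big_nat_recr//= IH /fringe_size_prob -!natr1.
have h (m : R) : 0 <= m -> m + 1 != 0 by move=> m0; rewrite gt_eqF// ltr_wpDl.
have h1 := h n%:R (ler0n _ _); have h2 := h (n%:R + 1) ltac:(by rewrite addr_ge0).
have h3 : n%:R + 2 != 0 :> R by rewrite gt_eqF// ltr_wpDl.
by field; rewrite ?h1 ?h2 ?h3.
Qed.

Lemma eseries_fringe_size_prob : (\sum_(0 <= k <oo) (fringe_size_prob k)%:E = 1)%E.
Proof.
apply/cvg_lim => //; under eq_fun do rewrite sumEFin sum_fringe_size_prob.
apply: cvg_EFin; first by near=> n.
rewrite (_ : fine \o _ = fun n => 1 - n.+1%:R^-1)//.
rewrite -[X in _ --> X]subr0; apply: cvgB; [exact: cvg_cst|exact: cvg_harmonic].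
Unshelve. all: by end_near. Qed.

End series.

Lemma measurable_extension : measurable_fun setT extension.
Proof. by []. Qed.

HB.instance Definition _ := isMeasurableFun.Build _ _ _ _ extension measurable_extension.

Section extended_fringe_law.
Context {R : realType} (keys : nat -> seq R).

Definition fringe_size_nng (k : nat) : {nonneg R} :=
  NngNum (ltW (@fringe_size_prob_gt0 R k)).

(* The limit law is that of the extension of a tree B_k of random size k with
   P(k) = 1/((k+1)(k+2)), k >= 0. *)
Definition extended_fringe_law : set btree -> \bar R :=
  mseries (fun k => mscale (fringe_size_nng k)
    (distribution (bst_prob (keys k)) extension)) 0.

HB.instance Definition _ := Measure.on extended_fringe_law.

Lemma extended_fringe_lawE (A : set btree) : extended_fringe_law A =
  (\sum_(0 <= k <oo) (fringe_size_prob k)%:E *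
     bst_prob (keys k) (extension @^-1` A))%E.
Proof. by []. Qed.

(** Serves for the total mass, with [A] the set of all trees, and for the concentration on full
    trees. *)
Lemma extended_fringe_law_extension (A : set btree) :
  (forall T, A (extension T)) -> extended_fringe_law A = 1%E.
Proof.
move=> AT; rewrite extended_fringe_lawE -eseries_fringe_size_prob.
apply: eq_eseriesr => k _.
have -> : extension @^-1` A = setT by apply/seteqP; split => // T _; exact: AT.
by rewrite probability_setT mule1.
Qed.

HB.instance Definition _ := @Measure_isProbability.Build _ _ R extended_fringe_law
  (extended_fringe_law_extension (fun _ => I)).

Hypothesis keys_size : forall n, size (keys n) = n.
Hypothesis keys_uniq : forall n, uniq (keys n).

Lemma bst_prob_tree k T :
  bst_prob (keys k) [set T] = ((nb_nodes T == k)%:R * bst_weight T)%:E.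
Proof. by rewrite bst_prob_set1 bst_pmfE// keys_size. Qed.

Lemma extended_fringe_law_tree T : extended_fringe_law [set extension T] =
  (fringe_size_prob (nb_nodes T) * bst_weight T)%:E.
Proof.
rewrite extended_fringe_lawE.
have -> : extension @^-1` [set extension T] = [set T].
  by apply/seteqP; split => u /= => [/(can_inj extensionK)|->].
rewrite (@eseries_single _ _ 0 (nb_nodes T))// => [|k kT].
  by rewrite bst_prob_tree eqxx mul1r.
by rewrite bst_prob_tree eq_sym (negbTE kT) mul0r mule0.
Qed.

Lemma bst_fringe_limit_tree T : T != EmptyTree ->
  bst_fringe_limit keys [set T] = (2 * fringe_size_prob (nb_nodes T) * bst_weight T)%:E.
Proof.
move=> T0; rewrite /bst_fringe_limit.
rewrite (@eseries_single _ _ 1 (nb_nodes T)) => [||k kT].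
- rewrite bst_prob_tree eqxx mul1r -EFinM /fringe_size_prob mulrA.
  by rewrite mulr1.
- by rewrite lt0n nb_nodes_eq0.
by rewrite bst_prob_tree eq_sym (negbTE kT) mul0r mule0.
Qed.

End extended_fringe_law.

(** * Moments and central limit theorem for the count of a fixed tree *)

Section fringe_count.
Context {R : realType} (T0 : btree).
Hypothesis T0_neq0 : T0 != EmptyTree.
Local Notation k := (nb_nodes T0).

Definition fringe_count (T : btree) : R := (nb_fringe (extension T0) (extension T))%:R.

Definition fringe_mean : R := 2 * fringe_size_prob k * bst_weight T0.

Lemma fringe_mean_gt0 : 0 < fringe_mean.
Proof. by rewrite !mulr_gt0 ?fringe_size_prob_gt0 ?bst_weight_gt0. Qed.

(** A tree with more than [k] nodes cannot itself equal [T0], so the root adds no copy and the count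
    is additive over the subtrees. *)
Lemma fringe_count_recursion (F : R -> R) n : (k < n)%N ->
  n%:R * bst_mean n (fun T => F (fringe_count T)) =
  \sum_(j < n) bst_mean j (fun l => bst_mean (n - 1 - j)
     (fun r => F (fringe_count l + fringe_count r))) :> R.
Proof.
case: n => // n kn; rewrite bst_meanS; apply: eq_bigr => j _.
apply: eq_bst_mean => l ln; rewrite subn1; apply: eq_bst_mean => r rn.
rewrite /fringe_count nb_fringe_extension_Node natrD natrD.
have jn := ltn_ord j; have -> : (Node l r == T0) = false.
  by apply/eqP => E; move: kn; rewrite -E nb_nodes_Node ln rn; lia.
by rewrite addr0.
Qed.

(** The means obey the linear recursion from [k + 1] on. Before that only [j = k] contributes, with
    mean P(B_k = T0), and this determines the slope. *)
Lemma fringe_count_mean n : (k < n)%N ->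
  \sum_(j < n) bst_mean j fringe_count = fringe_mean * (n%:R * (n%:R + 1) / 2) /\
  bst_mean n fringe_count = fringe_mean * n.+1%:R.
Proof.
have rec m : (k.+1 <= m)%N -> m%:R * bst_mean m fringe_count =
    2 * \sum_(j < m) bst_mean j fringe_count :> R.
  move=> km; rewrite (@fringe_count_recursion id)//.
  under eq_bigr => j _.
    rewrite (_ : bst_mean j _ = bst_mean j fringe_count + bst_mean (m - 1 - j) fringe_count).
      over.
    under eq_bst_mean do rewrite bst_meanD bst_mean_cst.
    by rewrite bst_meanD bst_mean_cst.
  rewrite big_split /= (sum_rev_ord (fun j => bst_mean j fringe_count)).
  by rewrite mulr2n mulrDl mul1r.
have <- : recursion_slope (fun j => bst_mean j fringe_count) k.+1 = fringe_mean.
  rewrite /recursion_slope big_ord_recr /= big1 => [|j _]; last first.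
    rewrite (@eq_bst_mean _ _ _ (fun=> 0)) ?bst_mean_cst// => T Tj.
    by rewrite /fringe_count nb_fringe_small// Tj.
  rewrite (@eq_bst_mean _ _ _ (fun T => (T == T0)%:R)) => [|T Tk]; last first.
    by rewrite /fringe_count nb_fringe_same_size.
  rewrite bst_mean_indic// add0r /fringe_mean /fringe_size_prob -natr1.
  have h1 : k%:R + 1 != 0 :> R by rewrite gt_eqF// ltr_wpDl.
  have h2 : k%:R + 2 != 0 :> R by rewrite gt_eqF// ltr_wpDl.
  by field; rewrite ?h1 ?h2.
by apply: linear_recursion.
Qed.

Definition centered_law n (f : R -> R) : R :=
  bst_mean n (fun T => f (fringe_count T - fringe_mean * n.+1%:R)).

Lemma centered_law_mean n : mean_functional (centered_law n).
Proof. exact: bst_mean_functional. Qed.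

Lemma centered_law_recursion n : (k < n)%N -> forall f : R -> R,
  n%:R * centered_law n f =
  \sum_(j < n) centered_law j (fun x => centered_law (n - 1 - j) (fun y => f (x + y))).
Proof.
move=> kn f; rewrite /centered_law.
rewrite (@fringe_count_recursion (fun x => f (x - fringe_mean * n.+1%:R)))//.
apply: eq_bigr => j _; apply: eq_bst_mean => l _; apply: eq_bst_mean => r _.
congr f; have -> : n.+1%:R = j.+1%:R + (n - 1 - j).+1%:R :> R.
  by rewrite -natrD; congr (_%:R); have := ltn_ord j; lia.
by ring.
Qed.

Lemma centered_law_id n : (k < n)%N ->
  centered_law n id = 0 /\ \sum_(j < n) centered_law j id = 0.
Proof.
move=> kn; have [S M] := fringe_count_mean kn.
have E j : centered_law j id = bst_mean j fringe_count - fringe_mean * j.+1%:R.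
  by rewrite /centered_law bst_meanD bst_mean_cst.
split; first by rewrite E M subrr.
under eq_bigr do rewrite E.
by rewrite sumrB S -mulr_sumr sum_succ subrr.
Qed.

Definition fringe_variance : R :=
  recursion_slope (fun j => centered_law j (fun x => x ^+ 2)) (2 * k.+1).

(** The cross term of [(x + y) ^+ 2] has mean twice the product of the two means. From [2 * k.+1]
    on, one of the two indices exceeds [k], where the mean is 0, so second moments obey the same
    linear recursion as the means. *)
Lemma centered_law_sqr n : (2 * k.+1 <= n)%N ->
  centered_law n (fun x => x ^+ 2) = fringe_variance * n.+1%:R /\
  \sum_(j < n) centered_law j (fun x => x ^+ 2) =
    fringe_variance * (n%:R * (n%:R + 1) / 2).
Proof.
have rec m : (2 * k.+1 <= m)%N -> m%:R * centered_law m (fun x => x ^+ 2) =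
    2 * \sum_(j < m) centered_law j (fun x => x ^+ 2).
  move=> km; rewrite centered_law_recursion; last by lia.
  rewrite mulr2n mulrDl mul1r.
  rewrite -[X in _ + X](sum_rev_ord (fun j => centered_law j (fun x => x ^+ 2))) -big_split.
  apply: eq_bigr => j _ /=; set i := (m - 1 - j)%N.
  have Lj := centered_law_mean j; have Li := centered_law_mean i.
  have E x : centered_law i (fun y => (x + y) ^+ 2) =
      x ^+ 2 + (2 * centered_law i id) * x + centered_law i (fun y => y ^+ 2).
    rewrite (_ : (fun y => _) = fun y => x ^+ 2 + (2 * x) * y + y ^+ 2).
      by rewrite !(meanD Li) (meanZ Li) (mean_cst Li); ring.
    by apply/funext => y; ring.
  under [X in centered_law j X]eq_fun do rewrite E.
  rewrite !(meanD Lj) (meanZ Lj) (mean_cst Lj).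
  have [kj|jk] := ltnP k j; first by rewrite (centered_law_id kj).1 mulr0 addr0.
  have ki : (k < i)%N by rewrite /i; lia.
  by rewrite (centered_law_id ki).1 mulr0 mul0r addr0.
by move=> kn; have [] := linear_recursion _ rec kn.
Qed.

Lemma fringe_variance_gt0 : 0 < fringe_variance.
Proof.
rewrite /fringe_variance /recursion_slope; apply: divr_gt0; last first.
  by apply: mulr_gt0; rewrite ?natr1 ltr0n.
rewrite mulr_gt0// mulnS addSn big_ord_recl /= ltr_pwDl//.
  rewrite /centered_law bst_mean0 /fringe_count nb_fringe_extension0//.
  by rewrite mulr1 sub0r sqrrN exprn_gt0// fringe_mean_gt0.
by rewrite sumr_ge0// => j _; apply: (mean_ge0 (centered_law_mean _)) => x; exact: sqr_ge0.
Qed.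

(** The shift [b] allows for centering by [n * beta] instead of [beta * (n + 1)]. *)
Lemma centered_law_clt (b x : R) :
  {for x, continuous (fun y : R =>
     fine (normal_prob 0 (Num.sqrt fringe_variance) `]-oo, y]%classic))} ->
  (fun n => centered_law n (fun y => ((y + b) / Num.sqrt n%:R <= x)%R%:R)) @ \oo -->
    fine (normal_prob 0 (Num.sqrt fringe_variance) `]-oo, x]%classic).
Proof.
have v0 := fringe_variance_gt0.
have [K HK] := @additive_recursion_gauss_mean R centered_law (2 * k.+1) fringe_variance
  centered_law_mean (fun n kn => @centered_law_recursion n ltac:(lia)) v0 isT
  (fun n kn => @centered_law_id n ltac:(lia)) centered_law_sqr.
apply: (@cvg_cdf_gauss R (fun n f => centered_law n (fun y => f ((y + b) / Num.sqrt n%:R)))).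
  by move=> n; exact: bst_mean_functional.
move=> M f f1 f2 T; exact: (cvg_rescaled_gauss_mean b v0 HK T).
Qed.

End fringe_count.

(** * Convergence of counts and of fringe tree distributions *)

Section convergence.
Context {R : realType} (keys : nat -> seq R).
Hypothesis keys_size : forall n, size (keys n) = n.
Hypothesis keys_uniq : forall n, uniq (keys n).

Lemma keys_expectation n (F : btree -> R) :
  ('E_(bst_prob (keys n))[F] = (bst_mean n F)%:E)%E.
Proof. by rewrite bst_expectation// keys_size. Qed.

Lemma keys_prob n (A : set btree) :
  bst_prob (keys n) A = (bst_mean n (\1_A))%:E.
Proof. by rewrite bst_prob_mean// keys_size. Qed.

Lemma keys_variance n (F : btree -> R) :
  ('V_(bst_prob (keys n))[F] = (bst_mean n (fun T => (F T - bst_mean n F) ^+ 2))%:E)%E.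
Proof.
by rewrite /variance unlock !keys_expectation.
Qed.

Lemma le_bst_mean n (F G : btree -> R) : (forall t, F t <= G t) ->
  bst_mean n F <= bst_mean n G.
Proof.
by move=> FG; apply: ler_sum => t _; rewrite ler_wpM2l// ltW// bst_weight_gt0.
Qed.

(** Chebyshev's inequality: [e ^+ 2] times the indicator of the event is at most
    [(G n T - c) ^+ 2]. *)
Lemma cvg_in_probability_L2 (G : nat -> btree -> R) (c C : R) (N : nat) :
  (forall n, (N <= n)%N -> (0 < n)%N ->
     bst_mean n (fun T => (G n T - c) ^+ 2) <= C / n%:R) ->
  cvg_in_probability (fun n => btree_rv (G n) : {RV (bst_prob (keys n)) >-> R}) c.
Proof.
move=> h e e0; rewrite (_ : (fun n => _) = EFin \o
  (fun n => bst_mean n (\1_[set T | e <= `|G n T - c|]))); last first.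
  by apply/funext => n; exact: keys_prob.
apply: cvg_EFin; first by near=> n.
apply: (@cvg_dist_natn _ _ _ (C / e ^+ 2) N) => n Nn n0.
rewrite /= sub0r normrN ger0_norm; last first.
  by apply: bst_mean_ge0 => T; rewrite indicE.
rewrite mulrAC ler_pdivlMr ?exprn_gt0//; apply: le_trans _ (h n Nn n0).
rewrite mulrC -bst_meanZ; apply: le_bst_mean => T; rewrite indicE.
have [Te|_] := boolP (T \in _); last by rewrite mulr0 sqr_ge0.
rewrite mulr1 -[leRHS]real_normK ?num_real// lerXn2r ?nnegrE ?(ltW e0)//.
by move: Te; rewrite inE.
Unshelve. all: by end_near. Qed.

Lemma fringe_probE t T : fringe_prob R T [set t] =
  (nb_fringe t T)%:R / (nb_nodes T)%:R.
Proof.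
rewrite /fringe_prob /nb_fringe; congr (_%:R / _); apply: eq_count => v /=.
by apply/asboolP/eqP.
Qed.

Lemma random_fringe_probE n t :
  random_fringe_prob (bst_prob (keys n)) extension [set t] =
  (bst_mean n (fun T => (nb_fringe t (extension T))%:R) / (2 * n).+1%:R)%:E.
Proof.
rewrite /random_fringe_prob keys_expectation; congr EFin.
rewrite mulrC -bst_meanZ; apply: eq_bst_mean => T Tn.
by rewrite fringe_probE nb_nodes_extension Tn mulrC.
Qed.

Lemma cvg_EFin_eventually (u w : nat -> R) (l : R) (N : nat) :
  (forall n, (N <= n)%N -> u n = w n) -> w @ \oo --> l ->
  (fun n => (u n)%:E) @ \oo --> l%:E.
Proof.
move=> uw wl; have W : (fun n => (w n)%:E) @ \oo --> l%:E.
  by apply: cvg_EFin wl; near=> n.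
apply: cvg_trans W; apply: near_eq_cvg; near=> n.
by rewrite uw//; near: n; exact: nbhs_infty_ge.
Unshelve. all: by end_near. Qed.

Lemma cvg_half (b : R) :
  (fun n : nat => b * n.+1%:R / (2 * n).+1%:R) @ \oo --> b / 2.
Proof.
apply: (@cvg_dist_natn _ _ _ `|b| 0) => n _ n0.
have p1 : 0 < n%:R :> R by rewrite ltr0n.
have p2 : 0 < (2 * n).+1%:R :> R by rewrite ltr0n.
have -> : b / 2 - b * n.+1%:R / (2 * n).+1%:R = - (b / (2 * (2 * n).+1%:R)).
  by rewrite -!natr1 natrM; field; rewrite -natrM natr1 pnatr_eq0.
rewrite normrN normrM ler_wpM2l// normrV ?unitfE ?mulf_neq0 ?gt_eqF//.
rewrite ger0_norm ?mulr_ge0 ?ler0n// lef_pV2 ?posrE ?mulr_gt0//.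
by rewrite -natrM ler_nat; lia.
Qed.

Lemma random_fringe_prob_cvg t (b : R) (N : nat) :
  (forall n, (N <= n)%N ->
     bst_mean n (fun T => (nb_fringe t (extension T))%:R) = b * n.+1%:R) ->
  (fun n => random_fringe_prob (bst_prob (keys n)) extension [set t]) @ \oo
    --> (b / 2)%:E.
Proof.
move=> h; rewrite (_ : (fun n => _) = EFin \o (fun n =>
  bst_mean n (fun T => (nb_fringe t (extension T))%:R) / (2 * n).+1%:R)).
  by apply: (@cvg_EFin_eventually _ _ _ N _ (@cvg_half b)) => n Nn; rewrite h.
by apply/funext => n; exact: random_fringe_probE.
Qed.

Section tree.
Variable T0 : btree.
Hypothesis T0_neq0 : T0 != EmptyTree.
Local Notation X := (@fringe_count R T0).
Local Notation beta := (@fringe_mean R T0).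
Local Notation v := (@fringe_variance R T0).
Local Notation k := (nb_nodes T0).

Lemma centered_law_sqrD (b : R) n : (2 * k.+1 <= n)%N ->
  bst_mean n (fun T => (X T - beta * n.+1%:R + b) ^+ 2) = v * n.+1%:R + b ^+ 2.
Proof.
move=> kn; have L := @centered_law_mean R T0 n.
have := @centered_law_sqr R _ T0_neq0 n kn; rewrite /centered_law => -[s _].
have kn' : (k < n)%N by lia.
have [m _] := @centered_law_id R _ T0_neq0 n kn'.
rewrite -[LHS]/(centered_law T0 n (fun x => (x + b) ^+ 2)).
rewrite (_ : (fun x => _) = fun x => x ^+ 2 + (2 * b) * x + b ^+ 2); last first.
  by apply/funext => x; ring.
by rewrite !(meanD L) (meanZ L) (mean_cst L) m /centered_law s mulr0 addr0.
Qed.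

(** Covers both laws of large numbers: [c = n] with [b = beta] for the count per key, and
    [c = 2 * n + 1] with [b = beta / 2] for the proportion of nodes. *)
Lemma centered_law_sqrD_le (b c : R) n : (2 * k.+1 <= n)%N -> n%:R <= c ->
  bst_mean n (fun T => ((X T - beta * n.+1%:R + b) / c) ^+ 2) <=
    (2 * v + b ^+ 2) / n%:R.
Proof.
move=> kn nc; have n0 : 0 < n%:R :> R by rewrite ltr0n; lia.
have n1 : 1 <= n%:R :> R by rewrite ler1n; lia.
have c0 := lt_le_trans n0 nc.
have v0 := @fringe_variance_gt0 R _ T0_neq0.
rewrite (_ : (fun T => _) = fun T => c^-1 ^+ 2 * (X T - beta * n.+1%:R + b) ^+ 2).
  rewrite bst_meanZ centered_law_sqrD// mulrC ler_pdivlMr//.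
  rewrite exprVn mulrAC ler_pdivrMr ?exprn_gt0//.
  apply: (@le_trans _ _ ((2 * v + b ^+ 2) * n%:R ^+ 2)); last first.
    apply: ler_wpM2l; first by rewrite addr_ge0 ?sqr_ge0// mulr_ge0// ltW.
    by rewrite lerXn2r ?nnegrE// ltW.
  rewrite expr2 mulrA; apply: ler_wpM2r; first exact: ltW.
  rewrite mulrDl lerD//; last by rewrite ler_peMr ?sqr_ge0.
  rewrite (_ : 2 * v * n%:R = v * (2 * n%:R)); last by ring.
  rewrite ler_wpM2l ?(ltW v0)// -natr1; lra.
by apply/funext => T; rewrite exprMn mulrC.
Qed.

Lemma fringe_count_cvg_in_probability :
  cvg_in_probability (fun n => btree_rv (fun T =>
    (nb_fringe (extension T0) (extension T))%:R / n%:R)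
    : {RV (bst_prob (keys n)) >-> R}) beta.
Proof.
apply: (@cvg_in_probability_L2 _ _ (2 * v + beta ^+ 2) (2 * k.+1)) => n kn n0.
rewrite (@eq_bst_mean _ _ _ (fun T => ((X T - beta * n.+1%:R + beta) / n%:R) ^+ 2)).
  exact: centered_law_sqrD_le.
move=> T _; rewrite -/(X T) -natr1; congr (_ ^+ 2); field.
by rewrite pnatr_eq0 -lt0n.
Qed.

Lemma fringe_prob_cvg_in_probability :
  cvg_in_probability (fun n => btree_rv (fun T =>
    fringe_prob R (extension T) [set extension T0])
    : {RV (bst_prob (keys n)) >-> R}) (beta / 2).
Proof.
apply: (@cvg_in_probability_L2 _ _ (2 * v + (beta / 2) ^+ 2) (2 * k.+1)) => n kn n0.
rewrite (@eq_bst_mean _ _ _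
    (fun T => ((X T - beta * n.+1%:R + beta / 2) / (2 * n).+1%:R) ^+ 2)).
  by apply: centered_law_sqrD_le => //; rewrite ler_nat; lia.
move=> T Tn; rewrite fringe_probE nb_nodes_extension Tn -/(X T); congr (_ ^+ 2).
by rewrite -!natr1 natrM; field; rewrite -natrM natr1 pnatr_eq0.
Qed.

Definition normalized_count (n : nat) (T : btree) : R :=
  ((nb_fringe (extension T0) (extension T))%:R - n%:R * beta) / Num.sqrt n%:R.

Lemma normalized_countE n T :
  normalized_count n T = (X T - beta * n.+1%:R + beta) / Num.sqrt n%:R.
Proof. by rewrite /normalized_count -/(X T) -natr1; congr (_ / _); ring. Qed.

Lemma normalized_count_mean n : (k < n)%N ->
  bst_mean n (normalized_count n) = beta / Num.sqrt n%:R.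
Proof.
move=> kn; have L := @centered_law_mean R T0 n.
have [m _] := @centered_law_id R _ T0_neq0 n kn.
rewrite (_ : normalized_count n = fun T =>
  (Num.sqrt n%:R)^-1 * ((X T - beta * n.+1%:R) + beta)).
  rewrite bst_meanZ -[bst_mean _ _]/(centered_law T0 n (fun x => x + beta)).
  by rewrite (meanD L) (mean_cst L) m add0r mulrC.
by apply/funext => T; rewrite normalized_countE mulrC.
Qed.

Lemma normalized_count_variance n : (2 * k.+1 <= n)%N ->
  bst_mean n (fun T => (normalized_count n T - bst_mean n (normalized_count n)) ^+ 2)
    = v * n.+1%:R / n%:R.
Proof.
move=> kn; rewrite normalized_count_mean; last by lia.
rewrite (_ : (fun T => _) = fun T =>
  n%:R^-1 * (X T - beta * n.+1%:R + 0) ^+ 2).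
  by rewrite bst_meanZ centered_law_sqrD// expr0n addr0 mulrC.
apply/funext => T; rewrite normalized_countE addr0 -mulrBl addrK exprMn mulrC.
by rewrite exprVn sqr_sqrtr.
Qed.

Lemma normalized_count_clt :
  let Y n : {RV (bst_prob (keys n)) >-> R} := btree_rv (normalized_count n) in
  [/\ cvg_in_distribution Y (normal_prob 0 (Num.sqrt v)),
      (fun n => 'E_(bst_prob (keys n))[Y n]%E) @ \oo --> 0%E &
      (fun n => 'V_(bst_prob (keys n))[Y n]%E) @ \oo --> (v)%:E].
Proof.
have v0 := @fringe_variance_gt0 R _ T0_neq0.
split.
- move=> x cx; have C := centered_law_clt T0_neq0 beta cx.
  rewrite -[X in _ --> X]fineK ?fin_num_measure//.
  rewrite (_ : (fun n => _) = EFin \o (fun n => centered_law T0 n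
    (fun y => ((y + beta) / Num.sqrt n%:R <= x)%R%:R))).
    by apply: cvg_EFin C; near=> n.
  apply/funext => n /=; rewrite /cdf /distribution /pushforward.
  rewrite [LHS]keys_prob; congr EFin; apply: eq_bst_mean => T _; rewrite indicE -normalized_countE.
  congr (nat_of_bool _)%:R; apply/idP/idP; rewrite inE /= in_itv//.
- under eq_fun do rewrite keys_expectation.
  apply: cvg_EFin; first by near=> n.
  apply: (@cvg_dist_sqrtn _ _ _ beta k.+1) => n kn _.
  rewrite /= sub0r normrN normalized_count_mean// ger0_norm// divr_ge0//.
  by rewrite ltW// fringe_mean_gt0.
- under eq_fun do rewrite keys_variance.
  apply: cvg_EFin; first by near=> n.
  apply: (@cvg_dist_natn _ _ _ v (2 * k.+1)) => n kn n0.
  rewrite /= normalized_count_variance// -natr1.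
  rewrite (_ : v - _ = - (v / n%:R)); last by field; rewrite pnatr_eq0 -lt0n.
  by rewrite normrN ger0_norm// divr_ge0// ltW.
Unshelve. all: by end_near. Qed.

End tree.

(** The one-node tree stands apart because its count is deterministic; the deviation from the limit
    is exactly [1 / n]. *)
Lemma bullet_count_cvg_in_probability :
  cvg_in_probability (fun n => btree_rv (fun T =>
    (nb_fringe bullet (extension T))%:R / n%:R)
    : {RV (bst_prob (keys n)) >-> R}) 1.
Proof.
apply: (@cvg_in_probability_L2 _ _ 1 0) => n _ n0.
have nn0 : n%:R != 0 :> R by rewrite pnatr_eq0 -lt0n.
rewrite (@eq_bst_mean _ _ _ (fun=> n%:R^-1 ^+ 2)) ?bst_mean_cst => [|T Tn].
  rewrite mul1r exprVn lef_pV2 ?posrE ?exprn_gt0 ?ltr0n//.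
  by rewrite expr2 ler_peMr// ler1n.
by rewrite nb_fringe_bullet_extension Tn -natr1; congr (_ ^+ 2); field.
Qed.

Lemma bullet_prob_cvg_in_probability :
  cvg_in_probability (fun n => btree_rv (fun T =>
    fringe_prob R (extension T) [set bullet])
    : {RV (bst_prob (keys n)) >-> R}) (1 / 2).
Proof.
apply: (@cvg_in_probability_L2 _ _ 1 0) => n _ n0.
rewrite (@eq_bst_mean _ _ _ (fun=> (1 / 2 / (2 * n).+1%:R) ^+ 2)) ?bst_mean_cst => [|T Tn].
  have h : (1 / 2 / (2 * n).+1%:R : R) <= n%:R^-1.
    rewrite -mulrA mul1r -invfM lef_pV2 ?posrE ?mulr_gt0 ?ltr0n//.
    by rewrite -natrM ler_nat; lia.
  apply: (@le_trans _ _ (n%:R^-1 ^+ 2)).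
    by rewrite lerXn2r ?nnegrE ?divr_ge0 ?invr_ge0.
  rewrite mul1r exprVn lef_pV2 ?posrE ?exprn_gt0 ?ltr0n//.
  by rewrite expr2 ler_peMr// ler1n.
rewrite fringe_probE nb_nodes_extension nb_fringe_bullet_extension Tn; congr (_ ^+ 2).
by rewrite -!natr1 natrM; field; rewrite -natrM natr1 pnatr_eq0.
Qed.

End convergence.

(* keys n are the n distinct real numbers from which B_n is built, so
   bst_prob (keys n) is the law of B_n; mu is the law of the limiting random
   fringe tree of the extended trees. *)
Theorem theorem4p1 (R : realType) (keys : nat -> seq R)
    (keys_size : forall n, size (keys n) = n)
    (keys_uniq : forall n, uniq (keys n)) :
  exists mu : probability btree R,
  [/\ mu [set t | full t] = 1%E,
      (forall t : btree, full t -> (0 < nb_internal t)%N ->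
        let k := nb_internal t in
        mu [set t] = ((1 / 2)%:E * bst_fringe_limit keys [set internal t])%E /\
        mu [set t] =
          ((1 / ((k%:R + 1) * (k%:R + 2)))%:E *
             bst_prob (keys k) [set internal t])%E),
      mu [set bullet] = (1 / 2)%:E,
      (forall n : nat,
        {ae bst_prob (keys n),
          forall T, nb_fringe bullet (extension T) = n.+1}) &
      exists beta : btree -> R,
      [/\ beta bullet = 1,
          (forall t : btree, full t -> (1 < nb_leaves t)%N ->
            let k := nb_internal t in
            [/\ 0 < beta t,
                (beta t)%:E = (2%:E * mu [set t])%E,
                (beta t)%:E = bst_fringe_limit keys [set internal t],
                (beta t)%:E =
                  ((2 / ((k%:R + 1) * (k%:R + 2)))%:E *
                     bst_prob (keys k) [set internal t])%E &
                exists gamma : R, 0 < gamma /\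
                let X (n : nat) : {RV (bst_prob (keys n)) >-> R} :=
                  btree_rv (fun T => ((nb_fringe t (extension T))%:R
                                        - n%:R * beta t) / Num.sqrt n%:R) in
                [/\ cvg_in_distribution X (normal_prob 0 gamma),
                    (fun n => 'E_(bst_prob (keys n))[X n]%E) @ \oo --> 0%E &
                    (fun n => 'V_(bst_prob (keys n))[X n]%E) @ \oo
                      --> (gamma ^+ 2)%:E]]),
          (forall t : btree, full t ->
            cvg_in_probability
              (fun n => btree_rv (fun T =>
                 (nb_fringe t (extension T))%:R / n%:R)
                 : {RV (bst_prob (keys n)) >-> R})
              (beta t)),
          (forall t : btree, full t ->
            (forall T : btree,
              fringe_prob R (extension T) [set t] =
              (nb_fringe t (extension T))%:R / (nb_nodes (extension T))%:R) /\
            cvg_in_probability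
              (fun n => btree_rv (fun T =>
                 fringe_prob R (extension T) [set t])
                 : {RV (bst_prob (keys n)) >-> R})
              (fine (mu [set t]))) &
          (forall t : btree, full t ->
            (forall n : nat,
              random_fringe_prob (bst_prob (keys n)) extension [set t] =
              'E_(bst_prob (keys n))[(fun T =>
                 (nb_fringe t (extension T))%:R
                   / (nb_nodes (extension T))%:R)%R]%E) /\
            (fun n =>
               random_fringe_prob (bst_prob (keys n)) extension [set t])
              @ \oo --> mu [set t])]].
Proof.
pose mu : probability btree R := extended_fringe_law keys.
exists mu.
pose beta t : R := if t == bullet then 1 else fringe_mean (internal t).
have betaE T : T != EmptyTree -> beta (extension T) = fringe_mean T.
  by move=> T0; rewrite /beta extension_eq_bullet (negbTE T0) extensionK.
have nodes0 : nb_nodes EmptyTree = 0%N by [].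
have bulletE : bullet = extension EmptyTree by [].
have lawE T : mu [set extension T] =
    (fringe_size_prob (nb_nodes T) * bst_weight T)%:E.
  exact: extended_fringe_law_tree.
have law_bullet : mu [set bullet] = (1 / 2)%:E.
  by rewrite bulletE lawE; congr EFin; rewrite /fringe_size_prob nodes0 /=; field.
(* The halving reflects that [fringe_mean] counts copies per key, while the extended tree has
   [2 * n + 1] nodes for [n] keys. *)
have half_mean T : fringe_size_prob (nb_nodes T) * bst_weight T = fringe_mean T / 2 :> R.
  by rewrite /fringe_mean; field.
have internal_gt0 T : (0 < nb_internal (extension T))%N -> T != EmptyTree.
  by rewrite nb_internal_extension lt0n nb_nodes_eq0.
have leaves_gt1 T : (1 < nb_leaves (extension T))%N -> T != EmptyTree.
  by rewrite nb_leaves_extension ltnS lt0n nb_nodes_eq0.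
split.
- by apply: extended_fringe_law_extension => T; exact: full_extension.
- move=> t /fullP[T ->] /internal_gt0 T0 k; rewrite /k nb_internal_extension extensionK.
  rewrite lawE bst_fringe_limit_tree// bst_prob_tree// eqxx -!EFinM.
  by split; congr EFin; [field|rewrite /fringe_size_prob !mul1r].
- exact: law_bullet.
- move=> n; exists [set T | nb_nodes T != size (keys n)]; split=> //.
    exact: bst_prob_nb_nodes.
  move=> T /=; apply: contra_notN => /eqP Tn.
  by rewrite nb_fringe_bullet_extension Tn keys_size.
exists beta; split.
- by rewrite /beta eqxx.
- move=> t /fullP[T ->] /leaves_gt1 T0 k; rewrite /k nb_internal_extension extensionK.
  rewrite betaE// lawE bst_fringe_limit_tree// bst_prob_tree// eqxx -!EFinM.
  split.
  + exact: fringe_mean_gt0.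
  + by congr EFin; rewrite /fringe_mean; ring.
  + by [].
  + by congr EFin; rewrite /fringe_mean /fringe_size_prob !mul1r.
  + have v0 := @fringe_variance_gt0 R _ T0.
    exists (Num.sqrt (fringe_variance T)); split; first by rewrite sqrtr_gt0.
    rewrite sqr_sqrtr ?(ltW v0)//.
    exact: normalized_count_clt keys_size keys_uniq _ T0.
- move=> t /fullP[T ->]; have [->|T0] := eqVneq T EmptyTree.
    rewrite /beta eqxx; exact: bullet_count_cvg_in_probability.
  by rewrite betaE//; exact: fringe_count_cvg_in_probability.
- move=> t /fullP[T ->]; split; first by move=> S; exact: fringe_probE.
  have [->|T0] := eqVneq T EmptyTree.
    rewrite -[extension EmptyTree]/bullet law_bullet /=.
    exact: bullet_prob_cvg_in_probability.
  rewrite lawE /= half_mean; exact: fringe_prob_cvg_in_probability.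
- move=> t /fullP[T ->]; split.
    move=> n; rewrite /random_fringe_prob; congr expectation.
    by apply/funext => S; exact: fringe_probE.
  rewrite lawE half_mean; have [->|T0] := eqVneq T EmptyTree.
    (* The formula for [fringe_mean] extends to the empty tree with the value assigned to [bullet],
       so the annealed limit takes the same form in both cases. *)
    have -> : fringe_mean EmptyTree = 1 :> R.
      by rewrite /fringe_mean /fringe_size_prob nodes0 /=; field.
    apply: (@random_fringe_prob_cvg _ _ _ _ _ _ 0) => // n _.
    rewrite (@eq_bst_mean _ _ _ (fun=> n.+1%:R)) ?bst_mean_cst ?mul1r// => S Sn.
    by rewrite nb_fringe_bullet_extension Sn.
  apply: (@random_fringe_prob_cvg _ _ _ _ _ _ (nb_nodes T).+1) => // n kn.
  by have [_] := @fringe_count_mean R _ T0 n kn.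
Qed.
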